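(* Let $\Pi$ be the generalized Riemann prime counting function of a Beurling generalized number system, and suppose that for some $0\le\theta<1$, \[ \Pi(x)=\int_1^x\frac{1-u^{-1}}{\log u}\,\mathrm{d}u+O(x^{\theta}). \] Then there is $\rho>0$ such that the generalized integer counting function $N$ satisfies, for each $c<\sqrt{2(1-\theta)}$, \[ N(x)=\rho x+O\bigl(x\exp(-c\sqrt{\log x\log\log x})\bigr). \]
   Context: A Beurling generalized prime system is an unbounded non-decreasing sequence of reals $1<p_1\le p_2\le\cdots$; its generalized integers form the multiplicative semigroup generated by $1$ and the $p_j$ (counted with multiplicity of representations). $\pi(x)$ counts generalized primes $\le x$, $N(x)$ counts generalized integers $\le x$, and $\Pi(x)=\sum_{j\ge1} j^{-1}\pi(x^{1/j})$. *)

(* Defs.v *)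
From HB Require Import structures.
From mathcomp Require Import all_boot all_order all_algebra finmap.
From mathcomp Require Import all_classical all_reals all_analysis.

Set Implicit Arguments.
Unset Strict Implicit.
Unset Printing Implicit Defensive.

Import Order.TTheory GRing.Theory Num.Theory.
Import numFieldNormedType.Exports.

Local Open Scope classical_set_scope.
Local Open Scope ring_scope.

(* Lets the Landau notations be used at +oo. *)
Canonical pinfty_filter_on (R : realType) :=
  FilterType (pinfty_nbhs R) (filter_filter (ProperFilter := proper_pinfty_nbhs)).

(* [p j] is the (j+1)-st generalized prime. *)
Definition beurling_primes (R : realType) (p : nat -> R) : Prop :=
  [/\ 1 < p 0%N, nondecreasing_seq p & ~ has_ubound (range p)].

(* Indices, not values, are counted, so repeated primes count repeatedly.
   [fset_set] is [fset0] on infinite sets; the set here is finite whenever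
   [beurling_primes p] holds. *)
Definition prime_count (R : realType) (p : nat -> R) (x : R) : nat :=
  #|` fset_set [set j | p j <= x] |.

(* Only finitely many terms are nonzero when [beurling_primes p] holds. *)
Definition riemann_count (R : realType) (p : nat -> R) (x : R) : R :=
  limn (fun n : nat =>
    \sum_(1 <= j < n) j%:R^-1 * (prime_count p (x `^ j%:R^-1))%:R : R).

(* A representation of a generalized integer is a finitely supported exponent
   sequence; the zero sequence represents 1. *)
Definition gen_integer (R : realType) (p : nat -> R)
    (e : {fsfun nat -> nat with 0%N}) : R :=
  \prod_(j <- finsupp e) p j ^+ e j.

(* Exponent sequences, not values, are counted, so each generalized integer is
   counted with its number of representations. *)
Definition integer_count (R : realType) (p : nat -> R) (x : R) : nat :=
  #|` fset_set [set e : {fsfun nat -> nat with 0%N} | gen_integer p e <= x] |.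

(* Main.v *)
Require Import Defs.
From mathcomp Require Import all_boot all_order all_algebra.
From mathcomp Require Import all_classical all_reals all_analysis.
From mathcomp Require Import measurable_realfun finmap ring lra zify.
Import Order.TTheory GRing.Theory Num.Theory.
Import numFieldNormedType.Exports.
Local Open Scope classical_set_scope.
Local Open Scope ring_scope.

(* Multiplicatively, dN = exp^*(dPi).  Write Pi = Pi_0 + E, with Pi_0 the
   integral of (1 - 1/u) / log u.  As exp^*(dPi_0) = delta_1 + du has mass x on
   [1, x], N(x) / x is the mass of exp^*(f) on [0, log x], where f is dE(u) / u
   in the variable log u.  The tail of f beyond z is O(exp (- alpha z)), with
   alpha = 1 - theta, and its total variation on [0, y] is V = O(log y), so
   cutting f at y / n shows that the mass of f^{*n} on [0, y] is F^n up to
   O(n V^(n-1) exp (- alpha y / n)), where F is the total mass of f.  Since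
   alpha y / n >= 2 sqrt (alpha lam y) - lam n for every lam >= 0, summation
   over n with the weights 1 / n! gives
     N(exp y) / exp y = exp F + O(exp (- 2 sqrt (alpha lam y) + lam + V exp lam)),
   and lam = kappa log y with kappa < 1/2 close to 1/2 gives the theorem.

   The convolutions are products of power series: logarithms of primes are
   rounded up to multiples of a mesh delta, and Pi_0 is replaced by the
   logarithm of (1 - q) / (1 - exp delta q), the generating series of the
   masses of delta_1 + du on the mesh intervals.  Letting delta tend to 0 for
   x bounded shows that N(x) / x is Cauchy, with the above rate. *)

(** * Truncated sums of coefficients of powers *)

Lemma sum_cauchy_product {R : pzRingType} (a b : nat -> R) (K : nat) :
  \sum_(k < K.+1) \sum_(j < k.+1) a j * b (k - j)%N =
  \sum_(i < K.+1) a i * \sum_(l < (K - i).+1) b l.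
Proof.
elim: K => [|K IH]; first by rewrite !big_ord1 /= ?big_ord1.
rewrite big_ord_recr /= IH [RHS]big_ord_recr /= subnn big_ord1.
rewrite [X in _ + X]big_ord_recr /= subnn addrA; congr (_ + _).
rewrite -big_split /=; apply: eq_bigr => i _.
have iK : (i <= K)%N by rewrite -ltnS.
by rewrite (subSn iK) [X in _ = _ * X]big_ord_recr /= mulrDr.
Qed.

(** A polynomial stands for a measure on a mesh, its coefficient at k being the mass at k delta.
    This is the mass of [0, K delta], and [pnorm] is the total variation there. *)
Definition psum {R : nzRingType} (K : nat) (p : {poly R}) : R :=
  \sum_(k < K.+1) p`_k.

Definition pnorm {R : numDomainType} (K : nat) (p : {poly R}) : R :=
  \sum_(k < K.+1) `|p`_k|.

Section TruncatedSums.
Context {R : realFieldType}.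
Implicit Types (p q f : {poly R}) (K L n k z w : nat).

Lemma psumM K p q : psum K (p * q) = \sum_(i < K.+1) p`_i * psum (K - i) q.
Proof.
rewrite /psum -(sum_cauchy_product (fun i => p`_i) (fun i => q`_i)).
by apply: eq_bigr => k _; rewrite coefM.
Qed.

Lemma psumZ K (c : R) p : psum K (c *: p) = c * psum K p.
Proof. by rewrite /psum mulr_sumr; apply: eq_bigr => k _; rewrite coefZ. Qed.

Lemma psumB K p q : psum K (p - q) = psum K p - psum K q.
Proof. by rewrite /psum -sumrB; apply: eq_bigr => k _; rewrite coefB. Qed.

Lemma psum_sum K n (F : 'I_n -> {poly R}) :
  psum K (\sum_(i < n) F i) = \sum_(i < n) psum K (F i).
Proof.
by rewrite /psum exchange_big /=; apply: eq_bigr => k _; rewrite coef_sum.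
Qed.

Lemma pnorm_ge0 K p : 0 <= pnorm K p.
Proof. by apply: sumr_ge0. Qed.

Lemma le_pnorm w K p : (w <= K)%N -> pnorm w p <= pnorm K p.
Proof.
move=> wK; rewrite /pnorm -(subnKC wK) -addSn big_split_ord /= lerDl.
by apply: sumr_ge0.
Qed.

Lemma norm_psum_le K p : `|psum K p| <= pnorm K p.
Proof. exact: ler_norm_sum. Qed.

Lemma pnormM K p q : pnorm K (p * q) <= pnorm K p * pnorm K q.
Proof.
have -> : pnorm K p * pnorm K q = \sum_(i < K.+1) `|p`_i| * pnorm K q.
  by rewrite /pnorm mulr_suml.
apply: (@le_trans _ _ (\sum_(i < K.+1) `|p`_i| * pnorm (K - i) q)).
  rewrite /pnorm -(sum_cauchy_product (fun i => `|p`_i|) (fun i => `|q`_i|)).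
  apply: ler_sum => k _; rewrite coefM.
  apply: le_trans (ler_norm_sum _ _ _) _.
  by apply: ler_sum => j _; rewrite normrM.
apply: ler_sum => i _; apply: ler_wpM2l => //.
by apply: le_pnorm; rewrite leq_subr.
Qed.

Lemma pnormX K p n : pnorm K (p ^+ n) <= pnorm K p ^+ n.
Proof.
elim: n => [|n IH].
  rewrite !expr0 /pnorm big_ord_recl coef1 /= normr1 big1 ?addr0 //.
  by move=> i _; rewrite coef1 normr0.
rewrite !exprS; apply: le_trans (pnormM _ _ _) _.
by apply: ler_wpM2l; rewrite ?pnorm_ge0.
Qed.

(* The part of f of degree at most z contributes exactly its value at 1 to the
   n-th power; every other term contains a factor from the tail of f, which is
   small whatever the remaining factors are. *)
Lemma psum_expr_close K f n z (V T : R) :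
  (n * z <= K)%N -> (z <= K)%N -> pnorm K f <= V ->
  (forall w, (z <= w <= K)%N -> `|psum w f - psum z f| <= T) ->
  `|psum K (f ^+ n) - psum K f ^+ n| <= (n%:R * V ^+ n.-1 * T) *+ 2.
Proof.
case: n => [|n] nzK zK fV tail.
  by rewrite !expr0 /psum big_ord_recl coef1 big1 ?addr0 ?subrr ?normr0 ?mul0r
    ?mul0rn // => i _; rewrite coef1.
have T0 : 0 <= T by apply: le_trans (tail z _) => //; rewrite leqnn zK.
have V0 : 0 <= V by apply: le_trans fV; apply: pnorm_ge0.
pose a := \poly_(i < z.+1) f`_i.
have psum_a w : psum w a = psum (minn w z) f.
  rewrite /psum; have [wz|zw] := leqP w z.
    by apply: eq_bigr => k _; rewrite coef_poly (leq_trans (ltn_ord k)).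
  rewrite [RHS](big_ord_widen w.+1 (fun i => f`_i)) 1?ltnW//.
  rewrite [RHS]big_mkcond; apply: eq_bigr => k _.
  by rewrite coef_poly.
have pnorm_a : pnorm K a <= V.
  apply: le_trans fV; apply: ler_sum => k _; rewrite coef_poly.
  by case: ifP; rewrite ?normr0.
have tail_a w : (w <= K)%N -> `|psum w (f - a)| <= T.
  move=> wK; rewrite psumB psum_a; have [wz|zw] := leqP w z.
    by rewrite subrr normr0.
  by apply: tail; rewrite wK ltnW.
(* The power has degree at most (n + 1) z <= K, so nothing is cut off: the sum is a value at 1,
   which is multiplicative. *)
have psum_aX : psum K (a ^+ n.+1) = psum K a ^+ n.+1.
  have hor q : (size q <= K.+1)%N -> psum K q = q.[1].
    move=> sq; rewrite (horner_coef_wide 1 sq).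
    by apply: eq_bigr => i _; rewrite expr1n mulr1.
  have sa : (size a <= z.+1)%N by apply: size_poly.
  rewrite !hor ?horner_exp //; first by apply: leq_trans sa _.
  apply: leq_trans (size_poly_exp_leq _ _) _.
  rewrite ltnS; apply: leq_trans nzK.
  by rewrite mulnC leq_mul2l -ltnS; case: (size a) sa => [|m] //=; rewrite ltnS.
(* Grouped by the coefficients of h, the product only involves partial sums of g, so the
   cancellation inside g is kept. *)
have psumMsmall (g h : {poly R}) : (forall w, (w <= K)%N -> `|psum w g| <= T) ->
    `|psum K (g * h)| <= pnorm K h * T.
  move=> gT; rewrite mulrC psumM; apply: le_trans (ler_norm_sum _ _ _) _.
  rewrite /pnorm mulr_suml; apply: ler_sum => i _; rewrite normrM.
  by apply: ler_wpM2l => //; apply: gT; rewrite leq_subr.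
have VX i j : (i + j = n)%N -> V ^+ i * V ^+ j = V ^+ n by move=> <-; rewrite exprD.
(* The difference of powers is f - a times a sum of n + 1 products, each of n factors f or a. *)
have step1 : `|psum K (f ^+ n.+1) - psum K (a ^+ n.+1)| <= n.+1%:R * V ^+ n * T.
  rewrite -psumB subrXX; apply: le_trans (psumMsmall _ _ tail_a) _.
  apply: ler_wpM2r => //.
  apply: (@le_trans _ _ (\sum_(i < n.+1) pnorm K (f ^+ (n.+1.-1 - i) * a ^+ i))).
    rewrite /pnorm exchange_big /=; apply: ler_sum => k _; rewrite coef_sum.
    exact: ler_norm_sum.
  rewrite mulr_natl -[n.+1 in leRHS]card_ord -sumr_const; apply: ler_sum => i _ /=.
  have iN : ((n - i) + i)%N = n by rewrite subnK // -ltnS.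
  apply: le_trans (pnormM _ _ _) _; rewrite -(VX _ _ iN).
  apply: ler_pM; rewrite ?pnorm_ge0 //; apply: le_trans (pnormX _ _ _) _;
    by apply: lerXn2r; rewrite ?nnegrE ?pnorm_ge0.
have step2 : `|psum K (a ^+ n.+1) - psum K f ^+ n.+1| <= n.+1%:R * V ^+ n * T.
  rewrite psum_aX distrC subrXX normrM mulrC.
  apply: ler_pM => //; last first.
    by rewrite psum_a (minn_idPr zK); apply: tail; rewrite leqnn zK.
  apply: le_trans (ler_norm_sum _ _ _) _.
  rewrite mulr_natl -[n.+1 in leRHS]card_ord -sumr_const; apply: ler_sum => i _ /=.
  rewrite normrM !normrX; have iN : ((n - i) + i)%N = n by rewrite subnK // -ltnS.
  rewrite -(VX _ _ iN).
  apply: ler_pM; rewrite ?exprn_ge0 //; apply: lerXn2r; rewrite ?nnegrE //.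
    exact: le_trans (norm_psum_le _ _) _.
  exact: le_trans (norm_psum_le _ _) _.
rewrite -(subrKA (psum K (a ^+ n.+1))) mulr2n.
by apply: le_trans (ler_normD _ _) _; apply: lerD.
Qed.

End TruncatedSums.

(** * Logarithmic derivatives of truncated power series *)

Section FormalLogarithm.
Context {R : numFieldType}.
Implicit Types (A B l p q : {poly R}) (L k n a : nat) (s : R).

Definition eqmodX L p q := forall k, (k <= L)%N -> p`_k = q`_k.

Lemma eqmodXM L p p' q q' :
  eqmodX L p p' -> eqmodX L q q' -> eqmodX L (p * q) (p' * q').
Proof.
move=> pp qq k kL; rewrite !coefM; apply: eq_bigr => j _.
have jk : (j <= k)%N by rewrite -ltnS.
by rewrite pp ?qq //; [apply: leq_trans kL; apply: leq_subr | apply: leq_trans kL].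
Qed.

Lemma eqmodX_prod L (I : Type) (r : seq I) (F G : I -> {poly R}) :
  (forall i, eqmodX L (F i) (G i)) ->
  eqmodX L (\prod_(i <- r) F i) (\prod_(i <- r) G i).
Proof.
move=> FG; elim: r => [|i r IH]; first by rewrite !big_nil.
by rewrite !big_cons; apply: eqmodXM.
Qed.

(** Unlike d/dX, the operator X d/dX preserves degrees, so identities modulo X^(L+1) keep their
    precision. *)
Definition eulerD p : {poly R} := 'X * p^`().

Lemma coef_eulerD p k : (eulerD p)`_k = k%:R * p`_k.
Proof.
rewrite /eulerD coefXM; case: k => [|k] /=; first by rewrite mul0r.
by rewrite coef_deriv mulr_natl.
Qed.

Lemma eulerDD p q : eulerD (p + q) = eulerD p + eulerD q.
Proof. by rewrite /eulerD derivD mulrDr. Qed.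

Lemma eulerDM p q : eulerD (p * q) = eulerD p * q + p * eulerD q.
Proof. by rewrite /eulerD derivM; ring. Qed.

(* Modulo X^(L+1), A is a constant multiple of exp l. *)
Definition log_mod L A l := eqmodX L (eulerD A) (eulerD l * A).

Lemma log_modM L A B l m :
  log_mod L A l -> log_mod L B m -> log_mod L (A * B) (l + m).
Proof.
move=> Al Bm k kL; rewrite eulerDM eulerDD coefD.
have -> : (eulerD l + eulerD m) * (A * B) =
  (eulerD l * A) * B + A * (eulerD m * B) by ring.
rewrite coefD; congr (_ + _); first exact: (eqmodXM _ _ _ _ _ Al (fun k _ => erefl _)).
exact: (eqmodXM _ _ _ _ _ (fun k _ => erefl _) Bm).
Qed.

Lemma log_mod1 L : log_mod L 1 0.
Proof. by move=> k _; rewrite /eulerD -polyC1 !derivC mulr0 mul0r. Qed.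

Lemma log_mod_prod L (I : Type) (r : seq I) (A l : I -> {poly R}) :
  (forall i, log_mod L (A i) (l i)) ->
  log_mod L (\prod_(i <- r) A i) (\sum_(i <- r) l i).
Proof.
move=> Al; elim: r => [|i r IH]; first by rewrite !big_nil; apply: log_mod1.
by rewrite !big_cons; apply: log_modM.
Qed.

(** The relation reads k A_k = sum over j of j l_j A_(k-j). Its term j = 0 vanishes, so A_k is
    determined by the coefficients below k. *)
Lemma log_mod_unique L A B l :
  log_mod L A l -> log_mod L B l -> A`_0 = B`_0 -> eqmodX L A B.
Proof.
move=> Al Bl AB0; elim/ltn_ind => -[//|k] IH kL.
have k0 : (k.+1%:R : R) != 0 by rewrite pnatr_eq0.
apply: (mulfI k0); rewrite -!coef_eulerD Al // Bl // !coefM [LHS]big_ord_recl [RHS]big_ord_recl.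
congr (_ + _); first by rewrite !coef_eulerD !mul0r.
apply: eq_bigr => j _; rewrite IH // ?lift0 ?subSS; first by rewrite ltnS leq_subr.
by apply: leq_trans kL; rewrite leqW // leq_subr.
Qed.

(** When l has no constant term, the powers beyond the L-th vanish modulo X^(L+1), so this is the
    whole exponential at that precision. *)
Definition exp_poly L l : {poly R} := \sum_(n < L.+1) (n`!%:R)^-1 *: l ^+ n.

Lemma coef_expr_small l n k : l`_0 = 0 -> (k < n)%N -> (l ^+ n)`_k = 0.
Proof.
move=> l0 kn.
have -> : l = 'X * \poly_(i < size l) l`_i.+1.
  apply/polyP => -[|i]; rewrite coefXM //= coef_poly.
  by case: ltnP => // h; rewrite nth_default // leqW.
by rewrite exprMn coefXnM kn.
Qed.

Lemma eulerD_exp_poly L l :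
  eulerD (exp_poly L.+1 l) = eulerD l * exp_poly L l.
Proof.
rewrite /eulerD /exp_poly raddf_sum big_ord_recl /= expr0 fact0 invr1 scale1r -polyC1 derivC add0r.
rewrite !mulr_sumr. apply: eq_bigr => i _; rewrite /= /bump add1n derivZ deriv_exp /=.
rewrite -[X in _ *: X]scaler_nat scalerA factS natrM invfM mulrAC mulVf ?pnatr_eq0 // mul1r.
by rewrite -!scalerAr; congr (_ *: _); ring.
Qed.

Lemma log_mod_exp L l : l`_0 = 0 -> log_mod L (exp_poly L l) l.
Proof.
move=> l0; case: L => [|L] k kL.
  move: kL; rewrite leqn0 => /eqP ->; rewrite coef_eulerD mul0r coefM big_ord1.
  by rewrite coef_eulerD !mul0r.
(* The Euler operator loses the top term of the exponential; that term times [eulerD l] has no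
   coefficient of degree L + 1 or less. *)
rewrite eulerD_exp_poly [in RHS]/exp_poly big_ord_recr /= mulrDr coefD.
rewrite [X in _ = _ + X](_ : _ = 0) ?addr0 // -scalerAr coefZ coefM big1 ?mulr0 //.
move=> [[|j] jk] _ /=; first by rewrite coef_eulerD !mul0r.
have kj : (k - j.+1 < L.+1)%N by lia.
by rewrite coef_expr_small ?mulr0.
Qed.

Lemma coef0_exp_poly L l : l`_0 = 0 -> (exp_poly L l)`_0 = 1.
Proof.
move=> l0; rewrite /exp_poly coef_sum big_ord_recl expr0 fact0 invr1 scale1r coef1 big1 ?addr0 //.
by move=> i _; rewrite coefZ coef_expr_small ?mulr0.
Qed.

(* 1 / (1 - (s X)^a) and its logarithm; the degree 0 coefficient of the
   logarithm is a / 0 = 0. *)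
Definition geom_poly L s a : {poly R} := \poly_(i < L.+1) ((a %| i)%N%:R * s ^+ i).
Definition log_geom L s a : {poly R} :=
  \poly_(i < L.+1) ((a %| i)%N%:R * a%:R / i%:R * s ^+ i).

Lemma sum_dvdn a k : (0 < a)%N -> (\sum_(i < k.+1 | (0 < i)%N) (a %| i) = k %/ a)%N.
Proof.
move=> a0; elim: k => [|k IH]; first by rewrite big_mkcond big_ord1 div0n.
by rewrite big_mkcond big_ord_recr /= -big_mkcond /= IH divnS // addnC.
Qed.

(** Both coefficients at k vanish unless a divides k. If it does, each of the k / a positive
    multiples of a up to k contributes a s^k on the right, in total k s^k. *)
Lemma log_mod_geom L s a : (0 < a)%N -> log_mod L (geom_poly L s a) (log_geom L s a).
Proof.
move=> a0 k kL; rewrite coef_eulerD coef_poly ltnS kL coefM.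
have step (j : 'I_k.+1) : (eulerD (log_geom L s a))`_j * (geom_poly L s a)`_(k - j)
    = ((a %| k)%N%:R * s ^+ k * a%:R) * (if (0 < j)%N then nat_of_bool (a %| j)%N else 0%N)%:R.
  have jk : (j <= k)%N by rewrite -ltnS.
  have jL : (j < L.+1)%N by rewrite ltnS (leq_trans jk).
  have kjL : (k - j < L.+1)%N by rewrite ltnS (leq_trans (leq_subr _ _)).
  rewrite coef_eulerD !coef_poly jL kjL.
  have [->|j0] := posnP j; first by rewrite !mul0r mulr0.
  have -> : s ^+ k = s ^+ j * s ^+ (k - j) by rewrite -exprD subnKC.
  have dvE : ((a %| k)%N%:R * (a %| j)%N%:R = (a %| j)%N%:R * (a %| k - j)%N%:R :> R).
    case aj : (a %| j)%N; rewrite ?mulr0 ?mul0r // mul1r mulr1.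
    by rewrite -[in LHS](subnK jk) dvdn_addl.
  have jn : (j%:R : R) != 0 by rewrite pnatr_eq0 -lt0n.
  have -> : j%:R * ((a %| j)%N%:R * a%:R / j%:R * s ^+ j) * ((a %| k - j)%N%:R * s ^+ (k - j))
    = (a %| j)%N%:R * (a %| k - j)%N%:R * (s ^+ j * s ^+ (k - j) * a%:R) by field.
  have -> : (a %| k)%N%:R * (s ^+ j * s ^+ (k - j)) * a%:R * (a %| j)%N%:R
   = (a %| k)%N%:R * (a %| j)%N%:R * (s ^+ j * s ^+ (k - j) * a%:R) by ring.
  by rewrite dvE.
rewrite (eq_bigr _ (fun j _ => step j)) -mulr_sumr -natr_sum -big_mkcond /= sum_dvdn //.
case ak : (a %| k)%N; last by rewrite !mul0r mulr0.
by rewrite !mul1r -mulrA -natrM mulnC divnK // mulrC.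
Qed.

(** Apply the Euler operator to (1 - X) G = 1, where G is the geometric series, and use the
    logarithm of G. *)
Lemma log_mod_1subX L : log_mod L (1 - 'X) (- log_geom L 1 1).
Proof.
have inv : eqmodX L ((1 - 'X) * geom_poly L 1 1) 1.
  move=> k kL; rewrite mulrBl mul1r coefB coefXM coef1 !coef_poly.
  rewrite ltnS kL dvd1n expr1n mulr1; case: k kL => [|k] kL; first by rewrite subr0.
  by rewrite /= ltnS ltnW // dvd1n expr1n mulr1 subrr.
have lg := log_mod_geom L 1 1 isT.
set G := geom_poly L 1 1 in inv lg *; set l := log_geom L 1 1 in lg *.
have refl p : eqmodX L p p by [].
have e1 : eqmodX L (eulerD (1 - 'X) * G + (1 - 'X) * eulerD G) 0.
  move=> k kL; rewrite -eulerDM coef_eulerD inv // coef1 coef0.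
  by case: k kL => [|k] _; rewrite ?mul0r ?mulr0.
have e2 : eqmodX L ((1 - 'X) * eulerD G) (eulerD l).
  move=> k kL; rewrite (eqmodXM _ _ _ _ _ (refl (1 - 'X)) lg) //.
  rewrite mulrCA (eqmodXM _ _ _ _ _ (refl (eulerD l)) inv) //.
  by rewrite mulr1.
have e3 : eqmodX L (eulerD (1 - 'X) * G) (- eulerD l).
  move=> k kL; have := e1 k kL; rewrite coefD coef0 e2 // coefN => /eqP.
  by rewrite addr_eq0 => /eqP.
move=> k kL.
have -> : eulerD (- l) = - eulerD l by rewrite /eulerD derivN mulrN.
rewrite -(eqmodXM _ _ _ _ _ e3 (refl (1 - 'X))) // -mulrA [G * _]mulrC.
by rewrite (eqmodXM _ _ _ _ _ (refl (eulerD (1 - 'X))) inv) // mulr1.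
Qed.

End FormalLogarithm.

(** * Coefficient sums of an exponential *)

Section ExponentialEstimate.
Context {R : realType}.
Implicit Types (x y V C alpha lam delta : R).

Lemma exp_partial_sum_cvg x :
  (fun n => \sum_(i < n) (i`!%:R)^-1 * x ^+ i) @ \oo --> expR x.
Proof.
rewrite [X in X @ _ --> _](_ : _ = series (exp_coeff x)); last first.
  apply/funext => n; rewrite /series /= big_mkord; apply: eq_bigr => i _.
  by rewrite /exp_coeff /= mulrC.
exact: is_cvg_series_exp_coeff.
Qed.

Lemma exp_partial_sum_le x n : 0 <= x -> \sum_(i < n) (i`!%:R)^-1 * x ^+ i <= expR x.
Proof.
move=> x0; have cv := exp_partial_sum_cvg x.
rewrite -(cvg_lim (@Rhausdorff R) cv).
apply: (nondecreasing_cvgn_le _ (cvgP _ cv) n).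
apply/nondecreasing_seqP => k; rewrite big_ord_recr /= lerDl.
by rewrite mulr_ge0 ?invr_ge0 ?ler0n ?exprn_ge0.
Qed.

(** The square of sqrt A - sqrt B is nonnegative, with A = alpha y / n, B = lam n and n = m + 1. *)
Lemma amgm_decay alpha lam y m : 0 <= alpha -> 0 <= lam -> 0 <= y ->
  expR (- (alpha * y / m.+1%:R)) <=
  expR (- (2 * Num.sqrt (alpha * lam * y))) * expR lam ^+ m.+1.
Proof.
move=> a0 l0 y0; rewrite -expRM_natl -expRD ler_expR.
have m0 : 0 < (m.+1%:R : R) by rewrite ltr0n.
set n : R := m.+1%:R in m0 *.
have ay : 0 <= alpha * y / n by rewrite divr_ge0 ?mulr_ge0 // ltW.
have nl : 0 <= n * lam by rewrite mulr_ge0 // ltW.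
have -> : alpha * lam * y = (alpha * y / n) * (n * lam) by field; rewrite gt_eqF.
rewrite sqrtrM //; set A := alpha * y / n in ay *; set B := n * lam in nl *.
have := sqr_ge0 (Num.sqrt A - Num.sqrt B).
by rewrite sqrrB mulr2n !sqr_sqrtr //; lra.
Qed.

(** For the n-th power, f is cut at degree K / n, and [amgm_decay] turns the decay of the tail into
    a factor exp (lam n). The weights n / n! = 1 / (n - 1)! then sum to exp (V exp lam). *)
Lemma psum_exp_poly_close (f : {poly R}) (L K : nat) C V alpha lam delta y :
  (K <= L)%N -> f`_0 = 0 -> 0 < delta -> 0 <= alpha -> 0 <= lam -> 0 <= C ->
  0 <= y <= K.+1%:R * delta -> pnorm K f <= V ->
  (forall z w, (z <= w <= K)%N ->
     `|psum w f - psum z f| <= C * expR (- (alpha * delta * z%:R))) ->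
  `|psum K (exp_poly L f) - expR (psum K f)| <=
  2 * C * expR (alpha * delta) *
    expR (- (2 * Num.sqrt (alpha * lam * y)) + lam + expR lam * V).
Proof.
move=> KL f0 d0 a0 l0 C0 /andP[y0 yK] fV tail.
set F := psum K f; set B := (X in _ <= X).
have V0 : 0 <= V by apply: le_trans fV; apply: pnorm_ge0.
set W := expR lam * V.
have W0 : 0 <= W by rewrite mulr_ge0 ?expR_ge0.
set D := 2 * C * expR (alpha * delta) * expR (- (2 * Num.sqrt (alpha * lam * y)) + lam).
have D0 : 0 <= D by rewrite !mulr_ge0 ?expR_ge0.
have term m : `|(m.+1`!%:R)^-1 * (psum K (f ^+ m.+1) - F ^+ m.+1)| <=
    D * ((m`!%:R)^-1 * W ^+ m).
  set z := (K %/ m.+1)%N.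
  have zK : (z <= K)%N by apply: leq_div.
  have nzK : (m.+1 * z <= K)%N by rewrite mulnC leq_divM.
  have h := psum_expr_close K f m.+1 z V (C * expR (- (alpha * delta * z%:R))) nzK zK fV
    (fun w H => tail z w H).
  (* Since y / (m + 1) <= (z + 1) delta, rounding the cut down to z costs a factor exp (alpha
     delta). *)
  have decay : expR (- (alpha * delta * z%:R)) <=
      expR (alpha * delta) * expR (- (alpha * y / m.+1%:R)).
    rewrite -expRD ler_expR.
    have zz : y / m.+1%:R <= delta * (z%:R + 1).
      rewrite ler_pdivrMr ?ltr0n //; apply: le_trans yK _.
      rewrite mulrC -mulrA ler_pM2l // natr1 -natrM ler_nat.
      by rewrite {1}(divn_eq K m.+1) -addnS mulSn addnC leq_add2r ltn_pmod.
    have := ler_wpM2l a0 zz; rewrite [leLHS]mulrA.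
    have -> : alpha * (delta * (z%:R + 1)) = alpha * delta * z%:R + alpha * delta by ring.
    by move: (alpha * y / m.+1%:R) (alpha * delta * z%:R) (alpha * delta) => u v w; lra.
  have h2 := amgm_decay alpha lam y m a0 l0 y0.
  rewrite normrM ger0_norm ?invr_ge0 ?ler0n //.
  have h3 : `|psum K (f ^+ m.+1) - F ^+ m.+1| <= m.+1%:R * V ^+ m *
     (2 * C * expR (alpha * delta) *
       (expR (- (2 * Num.sqrt (alpha * lam * y))) * expR lam ^+ m.+1)).
    apply: le_trans h _; rewrite /=.
    set E := expR (- (alpha * delta * _)) in decay *.
    have -> : m.+1%:R * V ^+ m * (C * E) *+ 2 = m.+1%:R * V ^+ m * (2 * C * E) by ring.
    apply: ler_wpM2l; first by rewrite mulr_ge0 ?exprn_ge0.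
    rewrite -[leRHS]mulrA ler_wpM2l ?mulr_ge0 //.
    by apply: le_trans decay _; rewrite ler_wpM2l ?expR_ge0.
  have fm : (m`!%:R : R) != 0 by rewrite pnatr_eq0 -lt0n fact_gt0.
  apply: (@le_trans _ _ ((m.+1`!%:R)^-1 * (m.+1%:R * V ^+ m *
     (2 * C * expR (alpha * delta) *
       (expR (- (2 * Num.sqrt (alpha * lam * y))) * expR lam ^+ m.+1))))).
    by rewrite ler_wpM2l ?invr_ge0 ?ler0n.
  rewrite le_eqVlt; apply/orP; left; apply/eqP.
  rewrite /D /W expRD factS natrM exprMn exprS; field.
  by rewrite fm ?nat1r ?natr1 pnatr_eq0.
(* The polynomial is padded to N terms: for n > L the power of f has no coefficient up to K, while
   the power of F need not vanish. The bound does not depend on N. *)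
have main N : (L < N)%N ->
    `|psum K (exp_poly L f) - \sum_(n < N) (n`!%:R)^-1 * F ^+ n| <= B.
  move=> LN.
  have -> : psum K (exp_poly L f) = \sum_(n < N) (n`!%:R)^-1 * psum K (f ^+ n).
    rewrite /exp_poly psum_sum -(subnKC LN) big_split_ord /=.
    rewrite [X in _ = _ + X]big1 ?addr0 => [|i _].
      by apply: eq_bigr => i _; rewrite psumZ.
    rewrite [psum _ _]big1 ?mulr0 // => k _; rewrite coef_expr_small //.
    by rewrite (leq_trans (ltn_ord k)) // addSn ltnS (leq_trans KL) // leq_addr.
  rewrite -sumrB; case: N LN => // N _; rewrite big_ord_recl /=.
  rewrite !expr0 [psum K 1](_ : _ = 1) ?subrr ?add0r; last first.
    by rewrite /psum big_ord_recl coef1 big1 ?addr0 // => i _; rewrite coef1.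
  apply: le_trans (ler_norm_sum _ _ _) _.
  apply: (@le_trans _ _ (\sum_(i < N) D * ((i`!%:R)^-1 * W ^+ i))).
    by apply: ler_sum => i _; rewrite -mulrBr; apply: term.
  rewrite -mulr_sumr /B expRD mulrA -/D ler_wpM2l //.
  exact: exp_partial_sum_le.
have cv : (fun N => `|psum K (exp_poly L f) - \sum_(n < N) (n`!%:R)^-1 * F ^+ n|)
    @ \oo --> `|psum K (exp_poly L f) - expR F|.
  apply: cvg_norm; apply: cvgB; [exact: cvg_cst | exact: exp_partial_sum_cvg].
by apply: (cvgr_to_le cv); exists L.+1 => // N /= LN; apply: main.
Qed.

End ExponentialEstimate.

(** * Rounded integers as an exponential *)

Section CountingIdentity.
Context {R : numFieldType}.
Implicit Types (s : R) (L K a : nat).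

Lemma eqmodX_geom L s a : (0 < a)%N ->
  eqmodX L (geom_poly L s a)
    (\sum_(m : 'I_L.+1) s ^+ (m * a)%N *: 'X^(m * a)).
Proof.
move=> a0 k kL; rewrite coef_poly ltnS kL coef_sum.
have cE (m : 'I_L.+1) : (s ^+ (m * a)%N *: 'X^(m * a) : {poly R})`_k =
    if (m * a)%N == k then s ^+ k else 0.
  by rewrite coefZ coefXn eq_sym; case: eqP => [->|_]; rewrite ?mulr1 ?mulr0.
rewrite (eq_bigr _ (fun m _ => cE m)) -big_mkcond /=.
case ak : (a %| k)%N.
  have qL : (k %/ a < L.+1)%N by rewrite ltnS (leq_trans (leq_div _ _)).
  rewrite (big_pred1 (Ordinal qL)) ?mul1r // => m; rewrite /= -val_eqE /=.
  by rewrite -[k in LHS](divnK ak) eqn_pmul2r.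
rewrite big_pred0 ?mul0r // => m; apply/negP => /eqP mak.
by rewrite -mak dvdn_mull in ak.
Qed.

Definition weighted_sum {J L : nat} (a : 'I_J -> nat)
  (e : {ffun 'I_J -> 'I_L.+1}) : nat := (\sum_(j < J) e j * a j)%N.

Lemma psum_1subXM K (p : {poly R}) : psum K ((1 - 'X) * p) = p`_K.
Proof.
have cE k : ((1 - 'X) * p)`_k = p`_k - ('X * p)`_k by rewrite mulrBl mul1r coefB.
elim: K => [|K IH].
  by rewrite /psum big_ord_recl big_ord0 addr0 cE coefXM subr0.
by rewrite /psum big_ord_recr /= -/(psum K _) IH cE coefXM /= addrC subrK.
Qed.

(** With s = exp (- delta) and q = s X, this is the logarithm of the product of the 1 / (1 -
    q^(a_j)), divided by (1 - q) / (1 - exp delta q); note that exp delta q = X. It is the mesh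
    version of dE(u) / u. *)
Definition log_ratio {J : nat} L s (a : 'I_J -> nat) : {poly R} :=
  \sum_(j < J) log_geom L s (a j) + (log_geom L s 1 - log_geom L 1 1).

Lemma coef0_log_ratio J L s (a : 'I_J -> nat) : (log_ratio L s a)`_0 = 0.
Proof.
have l0 c b : (log_geom L c b : {poly R})`_0 = 0.
  by rewrite coef_poly /= invr0 mulr0 mul0r.
by rewrite coefD coefB coef_sum !l0 subrr addr0 big1.
Qed.

(** The exponential is (1 - X) / (1 - s X) times the sum over e of (s X)^(weight of e). Taking
    partial sums undoes 1 - X, and 1 / (1 - s X) accumulates the weights up to K. *)
Lemma psum_exp_log_ratio J L K s (a : 'I_J -> nat) :
  (K <= L)%N -> (forall j, 0 < a j)%N ->
  psum K (exp_poly L (log_ratio L s a)) =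
  s ^+ K * #|[set e : {ffun 'I_J -> 'I_L.+1} | (weighted_sum a e <= K)%N]%SET|%:R.
Proof.
move=> KL a0.
pose W : {poly R} := (\prod_(j < J) geom_poly L s (a j)) * geom_poly L s 1.
have prodW : eqmodX L (exp_poly L (log_ratio L s a)) ((1 - 'X) * W).
  apply: (log_mod_unique _ _ _ (log_ratio L s a)).
  - exact/log_mod_exp/coef0_log_ratio.
  - have -> : log_ratio L s a = - log_geom L 1 1 +
        (\sum_(j < J) log_geom L s (a j) + log_geom L s 1).
      by rewrite /log_ratio addrA [RHS]addrC.
    apply: log_modM; first exact: log_mod_1subX.
    apply: log_modM; last exact: log_mod_geom.
    by apply: log_mod_prod => j; apply: log_mod_geom.
  rewrite coef0_exp_poly ?coef0_log_ratio // mulrBl coefB mul1r coefXM subr0.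
  have g0 b : (geom_poly L s b : {poly R})`_0 = 1 by rewrite coef_poly /= dvdn0 mulr1.
  rewrite /W -!horner_coef0 hornerM horner_prod horner_coef0 g0 mulr1 big1 //.
  by move=> j _; rewrite horner_coef0.
have -> : psum K (exp_poly L (log_ratio L s a)) = psum K ((1 - 'X) * W).
  apply: eq_bigr => k _; apply: prodW; apply: leq_trans KL.
  by rewrite -ltnS.
rewrite psum_1subXM.
pose P : {poly R} := \sum_(e : {ffun 'I_J -> 'I_L.+1})
   s ^+ weighted_sum a e *: 'X^(weighted_sum a e).
have prodP : eqmodX L (\prod_(j < J) geom_poly L s (a j)) P.
  move=> k kL; rewrite (eqmodX_prod L _ _ _
     (fun j => \sum_(m : 'I_L.+1) s ^+ (m * a j)%N *: 'X^(m * a j))) //; last first.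
    by move=> j; apply: eqmodX_geom.
  suff <- : \prod_(j < J) (\sum_(m : 'I_L.+1) s ^+ (m * a j)%N *: 'X^(m * a j)) = P by [].
  rewrite bigA_distr_bigA; apply: eq_bigr => e _.
  by rewrite scaler_prod !prodrXr.
rewrite /W (eqmodXM _ _ _ _ _ prodP (fun k _ => erefl _)) // coefM.
have -> : \sum_(i < K.+1) P`_i * (geom_poly L s 1)`_(K - i) =
    \sum_(e : {ffun 'I_J -> 'I_L.+1}) \sum_(i < K.+1)
      (if (weighted_sum a e == i)%N then s ^+ K else 0).
  rewrite exchange_big /=; apply: eq_bigr => i _.
  have iK : (i <= K)%N by rewrite -ltnS.
  rewrite coef_sum mulr_suml; apply: eq_bigr => e _.
  rewrite coef_poly ltnS (leq_trans (leq_subr _ _)) // dvd1n mul1r coefZ coefXn eq_sym.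
  by case: eqP => [->|_]; rewrite ?mulr1 ?mulr0 ?mul0r // -exprD subnKC.
rewrite -sum1_card natr_sum mulr_sumr [RHS]big_mkcond; apply: eq_bigr => e _ /=.
rewrite inE mulr1 -big_mkcond /=; case: leqP => eK.
  have eK' : (weighted_sum a e < K.+1)%N by [].
  by rewrite (big_pred1 (Ordinal eK')) // => i; rewrite /= -val_eqE /= eq_sym.
by rewrite big_pred0 // => i; apply/negP => /eqP ei; have := ltn_ord i; rewrite -ei ltnS leqNgt eK.
Qed.

End CountingIdentity.

(** * Tail and variation of the logarithm *)

Section DiscreteLogarithm.
Context {R : realType}.
Implicit Types (s t b C alpha delta v : R).

(** Summation by parts. Each step costs at most C t^k (1 - s) <= b C (t^k - t^(k+1)), which
    telescopes; no factor 1 / (1 - t), unbounded for a fine mesh, appears. *)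
Lemma abel_tail (e : nat -> R) s t b C (L z w : nat) :
  0 < s -> s <= 1 -> 0 <= t -> t <= 1 -> 0 <= b -> 0 <= C ->
  1 - s <= b * (1 - t) ->
  (forall k, (k <= L)%N -> `|\sum_(i < k.+1) e i| * s ^+ k <= C * t ^+ k) ->
  (z <= w <= L)%N ->
  `|\sum_(i < w.+1) s ^+ i * e i - \sum_(i < z.+1) s ^+ i * e i| <=
  C * (2 + b) * t ^+ z.
Proof.
move=> s0 s1 t0 t1 b0 C0 st Ebound /andP[zw wL].
pose S k := \sum_(i < k.+1) s ^+ i * e i; pose E k := \sum_(i < k.+1) e i.
rewrite -/(S w) -/(S z).
have sn k : 0 <= s ^+ k by rewrite exprn_ge0 // ltW.
have main d : (z + d <= L)%N ->
    `|S (z + d)%N - S z - s ^+ (z + d) * E (z + d)%N| <=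
    C * t ^+ z + b * C * (t ^+ z - t ^+ (z + d)).
  elim: d => [|d IH] zdL.
    rewrite addn0 !subrr mulr0 addr0 sub0r normrN normrM ger0_norm //.
    by rewrite [leLHS]mulrC; apply: Ebound; rewrite addn0 in zdL.
  rewrite addnS in zdL *.
  have -> : S (z + d).+1 - S z - s ^+ (z + d).+1 * E (z + d).+1 =
     (S (z + d)%N - S z - s ^+ (z + d) * E (z + d)%N) + s ^+ (z + d) * E (z + d)%N * (1 - s).
    by rewrite /S /E !(big_ord_recr (z + d).+1) /= exprS; ring.
  apply: le_trans (ler_normD _ _) _.
  have -> : C * t ^+ z + b * C * (t ^+ z - t ^+ (z + d).+1) =
    (C * t ^+ z + b * C * (t ^+ z - t ^+ (z + d))) + C * t ^+ (z + d) * (b * (1 - t)).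
    by rewrite exprS; ring.
  apply: lerD; first by apply: IH; rewrite ltnW.
  have s1' : 0 <= 1 - s by rewrite subr_ge0.
  rewrite !normrM (ger0_norm s1') (ger0_norm (sn _)).
  apply: ler_pM => //; first by rewrite mulr_ge0.
  by rewrite [leLHS]mulrC; apply: Ebound; rewrite ltnW.
have tz0 : 0 <= t ^+ z by rewrite exprn_ge0.
have tw0 : 0 <= t ^+ w by rewrite exprn_ge0.
have twz : t ^+ w <= t ^+ z.
  by rewrite -(subnKC zw) exprD ler_piMr // exprn_ile1.
have := main (w - z)%N; rewrite subnKC // => /(_ wL) U.
have E1 : `|s ^+ w * E w| <= C * t ^+ w.
  by rewrite normrM ger0_norm // [leLHS]mulrC Ebound.
have -> : S w - S z = (S w - S z - s ^+ w * E w) + s ^+ w * E w by rewrite subrK.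
apply: le_trans (ler_normD _ _) _; apply: le_trans (lerD U E1) _.
have h1 : C * t ^+ w <= C * t ^+ z by rewrite ler_wpM2l.
have h2 : b * C * (t ^+ z - t ^+ w) <= b * C * t ^+ z.
  by rewrite ler_wpM2l ?mulr_ge0 // gerBl.
have -> : C * (2 + b) * t ^+ z = C * t ^+ z + b * C * t ^+ z + C * t ^+ z by ring.
by apply: lerD => //; apply: lerD.
Qed.

Lemma expRN_le_invD1 v : 0 <= v -> expR (- v) <= (1 + v)^-1.
Proof.
move=> v0; rewrite expRN lef_pV2 ?posrE ?expR_gt0 ?expR_ge1Dx //.
by rewrite ltr_pwDl.
Qed.

Lemma one_sub_expRN_ge v : 0 <= v <= 1 -> v / 2 <= 1 - expR (- v).
Proof.
move=> /andP[v0 v1]; have h := expRN_le_invD1 v v0.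
have h2 : (1 + v)^-1 <= 1 - v / 2.
  rewrite -[leLHS]mul1r ler_pdivrMr ?ltr_pwDl //; nra.
lra.
Qed.

Lemma one_sub_expRN_le v : 0 <= v -> 1 - expR (- v) <= 2 * v / (1 + v).
Proof.
move=> v0; have vp : 0 < 1 + v by rewrite ltr_pwDl.
rewrite ler_pdivlMr //; have := expR_ge1Dx (- v); have := expR_ge0 (- v).
by have [v1|v1] := leP v 1; nra.
Qed.

(** The k-th term is at most 2 delta / (1 + k delta), hence at most twice the increment of ln (1 + k
    delta). This is the source of the logarithmic total variation. *)
Lemma sum_one_sub_expRN_le delta K : 0 < delta ->
  \sum_(i < K.+1) (1 - expR (- delta) ^+ i) / i%:R <= 2 * ln (1 + K%:R * delta).
Proof.
move=> d0; elim: K => [|K IH].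
  by rewrite big_ord1 invr0 mulr0 mul0r addr0 ln1 mulr0.
rewrite big_ord_recr /=; set k := K.+1.
have k0 : 0 < (k%:R : R) by rewrite ltr0n.
have kd : 0 < 1 + k%:R * delta by rewrite ltr_pwDl // mulr_ge0 // ltW.
have Kd : 0 < 1 + K%:R * delta by rewrite ltr_pwDl // mulr_ge0 // ltW.
have step : (1 - expR (- delta) ^+ k) / k%:R <= 2 * (delta / (1 + k%:R * delta)).
  rewrite ler_pdivrMr // -expRM_natl mulrN.
  apply: le_trans (one_sub_expRN_le (k%:R * delta) _) _.
    by rewrite mulr_ge0 // ltW.
  by rewrite le_eqVlt; apply/orP; left; apply/eqP; field; rewrite gt_eqF.
have lnstep : ln (1 + K%:R * delta) <= ln (1 + k%:R * delta) - delta / (1 + k%:R * delta).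
  have -> : 1 + K%:R * delta = (1 + k%:R * delta) * (1 - delta / (1 + k%:R * delta)).
    by rewrite /k -natr1; field; rewrite natr1 gt_eqF.
  have q0 : 0 < 1 - delta / (1 + k%:R * delta).
    rewrite subr_gt0 ltr_pdivrMr // mul1r /k -natr1.
    by have := mulr_ge0 (ler0n R K) (ltW d0); lra.
  rewrite lnM ?posrE // lerD2l.
  by apply: le_ln1Dx; lra.
by apply: le_trans (lerD IH step) _; rewrite -mulrDr ler_pM2l // -lerBrDr.
Qed.

(** A prime whose powers up to x are the first n contributes this amount to Pi(x). *)
Definition harmonic_sum (n : nat) : R := \sum_(i < n) i.+1%:R^-1.

(** The sum of the coefficients up to k of the logarithm of (1 - q) / (1 - exp delta q), playing the
    role of Pi_0(exp (k delta)). The term i = 0 is 0 / 0 = 0. *)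
Definition log_zeta0_sum delta (k : nat) : R :=
  \sum_(i < k.+1) (expR (i%:R * delta) - 1) / i%:R.

Lemma sum_dvdn_harmonic (a k : nat) : (0 < a)%N ->
  \sum_(i < k.+1) (a %| i)%N%:R * a%:R / i%:R = harmonic_sum (k %/ a).
Proof.
move=> a0; elim: k => [|k IH].
  by rewrite big_ord1 invr0 mulr0 div0n /harmonic_sum big_ord0.
rewrite big_ord_recr /= IH divnS //; case ak : (a %| k.+1)%N; last first.
  by rewrite !mul0r addr0.
rewrite mul1r add1n [RHS]big_ord_recr /=; congr (_ + _).
have an : (a%:R : R) != 0 by rewrite pnatr_eq0 -lt0n.
have -> : (k.+1%:R : R) = (k %/ a).+1%:R * a%:R.
  by rewrite -natrM -[X in X%:R](divnK ak) divnS // ak.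
by rewrite invfM mulrCA mulfV // mulr1.
Qed.

Lemma coef_log_ratio {J : nat} (L : nat) delta (a : 'I_J -> nat) (k : nat) :
  (k <= L)%N ->
  (log_ratio L (expR (- delta)) a)`_k = expR (- delta) ^+ k *
    (\sum_(j < J) (a j %| k)%N%:R * (a j)%:R / k%:R - (expR (k%:R * delta) - 1) / k%:R).
Proof.
move=> kL; rewrite coefD coefB coef_sum !coef_poly ltnS kL !dvd1n !mul1r expr1n.
have -> : \sum_(j < J) (log_geom L (expR (- delta)) (a j))`_k =
   \sum_(j < J) expR (- delta) ^+ k * ((a j %| k)%N%:R * (a j)%:R / k%:R).
  by apply: eq_bigr => j _; rewrite coef_poly ltnS kL mulrC.
rewrite -mulr_sumr mulrBr; congr (_ + _).
have -> : expR (k%:R * delta) = (expR (- delta) ^+ k)^-1.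
  by rewrite -expRM_natl mulrN expRN invrK.
set x := expR (- delta) ^+ k.
have x0 : x != 0 by rewrite expf_neq0 // gt_eqF ?expR_gt0.
rewrite [in RHS]mulrA mulrBr mulfV // mulr1; ring.
Qed.

(** The tail comes from [abel_tail] with s = exp (- delta) and t = exp (- alpha delta). The
    variation is the signed mass, bounded by the tail at z = 0, plus twice the variation of the
    smooth part. *)
Lemma log_ratio_bounds {J : nat} (L : nat) delta alpha C (a : 'I_J -> nat) :
  0 < delta <= 1 -> 0 < alpha <= 1 -> 0 <= C -> (forall j, 0 < a j)%N ->
  (forall k, (k <= L)%N ->
     `|\sum_(j < J) harmonic_sum (k %/ a j) - log_zeta0_sum delta k| <=
     C * expR ((1 - alpha) * (k%:R * delta))) ->
  let f := log_ratio L (expR (- delta)) a in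
  (forall z w, (z <= w <= L)%N ->
     `|psum w f - psum z f| <= C * (2 + 2 / alpha) * expR (- (alpha * delta * z%:R))) /\
  (forall K, (K <= L)%N ->
     pnorm K f <= C * (2 + 2 / alpha) + 4 * ln (1 + K%:R * delta)).
Proof.
move=> /andP[d0 d1] /andP[al0 al1] C0 a0 hE f.
pose e k := \sum_(j < J) (a j %| k)%N%:R * (a j)%:R / k%:R - (expR (k%:R * delta) - 1) / k%:R.
have sumE k : \sum_(i < k.+1) e i =
    \sum_(j < J) harmonic_sum (k %/ a j) - log_zeta0_sum delta k.
  rewrite sumrB exchange_big; congr (_ - _).
  by apply: eq_bigr => j _; apply: sum_dvdn_harmonic.
have psumE k : (k <= L)%N -> psum k f = \sum_(i < k.+1) expR (- delta) ^+ i * e i.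
  move=> kL; apply: eq_bigr => i _; rewrite coef_log_ratio //.
  by apply: leq_trans kL; rewrite -ltnS.
have tail z w : (z <= w <= L)%N ->
    `|psum w f - psum z f| <= C * (2 + 2 / alpha) * expR (- (alpha * delta * z%:R)).
  move=> zwL; have /andP[zw wL] := zwL.
  rewrite !psumE ?(leq_trans zw) //.
  have -> : expR (- (alpha * delta * z%:R)) = expR (- (alpha * delta)) ^+ z.
    by rewrite -expRM_natl mulrN [in RHS]mulrC.
  have ad0 : 0 <= alpha * delta by rewrite mulr_ge0 // ltW.
  apply: (abel_tail e _ _ _ _ L) => //.
  - by rewrite expR_gt0.
  - by rewrite -expR0 ler_expR lerNl oppr0 ltW.
  - by rewrite -expR0 ler_expR lerNl oppr0.
  - by rewrite divr_ge0 // ltW.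
  (* Here b = 2 / alpha: 1 - s <= delta, while 1 - t >= alpha delta / 2 as alpha delta <= 1. *)
  - have h1 : 1 - expR (- delta) <= delta by have := expR_ge1Dx (- delta); lra.
    apply: le_trans h1 _.
    have ad1 : 0 <= alpha * delta <= 1 by rewrite ad0 mulr_ile1 // ltW.
    have := one_sub_expRN_ge _ ad1.
    move=> h2; rewrite mulrAC ler_pdivlMr //; lra.
  move=> k kL; rewrite sumE; apply: le_trans (ler_wpM2r _ (hE k kL)) _.
    by rewrite exprn_ge0 ?expR_ge0.
  rewrite -!expRM_natl -mulrA -expRD ler_wpM2l // ler_expR; lra.
split=> // K KL.
(* The coefficient is u - v with u, v >= 0, u from the primes and v from the smooth part, so its
   absolute value is at most u + v = (u - v) + 2 v. *)
have e0 i : `|f`_i| <= f`_i + 2 * ((1 - expR (- delta) ^+ i) / i%:R) \/ (L < i)%N.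
  have [iL|] := leqP i L; last by right.
  left; rewrite coef_log_ratio // mulrBr.
  set x := expR (- delta) ^+ i.
  have x0 : 0 < x by rewrite exprn_gt0 ?expR_gt0.
  have -> : x * ((expR (i%:R * delta) - 1) / i%:R) = (1 - x) / i%:R.
    have -> : expR (i%:R * delta) = x^-1 by rewrite /x -expRM_natl mulrN expRN invrK.
    by rewrite mulrA mulrBr mulfV ?mulr1 // gt_eqF.
  set u := x * _; set v := (1 - x) / _.
  have u0 : 0 <= u.
    by rewrite mulr_ge0 ?(ltW x0) // sumr_ge0.
  have v0 : 0 <= v.
    rewrite mulr_ge0 // subr_ge0 exprn_ile1 ?expR_ge0 //.
    by rewrite -expR0 ler_expR lerNl oppr0 ltW.
  by rewrite ler_norml; lra.
have h1 : pnorm K f <= psum K f + 2 * \sum_(i < K.+1) (1 - expR (- delta) ^+ i) / i%:R.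
  rewrite mulr_sumr -big_split /=; apply: ler_sum => i _.
  case: (e0 i) => // Li; have := ltn_ord i; lia.
apply: le_trans h1 _; apply: lerD.
  have := tail 0%N K; rewrite /= KL mulr0 oppr0 expR0 mulr1 => /(_ isT).
  rewrite [psum 0 f]big_ord1 coef0_log_ratio subr0.
  by apply: le_trans; apply: ler_norm.
have := sum_one_sub_expRN_le delta K d0; lra.
Qed.

End DiscreteLogarithm.

(** * The integral of (1 - 1/u) / ln u *)

Section PrincipalTerm.
Context {R : realType}.
Implicit Types (u v w x : R).

Definition prime_density u : R := (1 - u^-1) / ln u.

Definition prime_integral x : R :=
  \int[lebesgue_measure]_(u in `[1, x]) prime_density u.

Lemma prime_density_ge0 u : 1 <= u -> 0 <= prime_density u.
Proof.
move=> u1; apply: divr_ge0; last exact: ln_ge0.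
by rewrite subr_ge0 invf_le1 // (lt_le_trans ltr01).
Qed.

Lemma prime_density_exp w : prime_density (expR w) = (1 - expR (- w)) / w.
Proof. by rewrite /prime_density expRK expRN. Qed.

(** In the variable w = ln u the density is (1 - exp (- w)) / w, the mean of exp (- t) over [0, w].
    The inequality a (1 - exp (- b)) <= b (1 - exp (- a)) follows from 1 + x <= exp x at x = a - b
    and x = a. *)
Lemma prime_density_antitone u v : 1 < u -> u <= v ->
  prime_density v <= prime_density u.
Proof.
move=> u1 uv; have u0 : 0 < u by apply: lt_trans u1.
have v0 : 0 < v by apply: lt_le_trans uv.
have a0 : 0 < ln u by rewrite ln_gt0.
have ab : ln u <= ln v by rewrite ler_ln.
rewrite -[v in leLHS]lnK ?posrE // -[u in leRHS]lnK ?posrE // !prime_density_exp.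
set a := ln u in a0 ab *; set b := ln v in ab *.
have b0 : 0 < b by apply: lt_le_trans ab.
rewrite ler_pdivrMr // mulrAC ler_pdivlMr //.
have E0 := expR_ge0 (- a).
have h1 : expR (- a) * (1 - (b - a)) <= expR (- b).
  have -> : - b = - a + (- (b - a)) by lra.
  by rewrite expRD ler_wpM2l //; have := expR_ge1Dx (- (b - a)); lra.
have h2 : a * expR (- a) <= 1 - expR (- a).
  have e1 : expR a * expR (- a) = 1 by rewrite -expRD subrr expR0.
  have := ler_wpM2r E0 (expR_ge1Dx a); rewrite e1; lra.
have := ler_wpM2r (ltW a0) h1.
have ba : 0 <= b - a by lra.
have := ler_wpM2r ba h2; nra.
Qed.

Lemma prime_density_le1 u : 1 <= u -> prime_density u <= 1.
Proof.
rewrite le_eqVlt => /predU1P[<-|u1].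
  by rewrite /prime_density invr1 subrr mul0r.
rewrite ler_pdivrMr ?ln_gt0 // mul1r.
have u0 : 0 < u by apply: lt_trans u1.
have := expR_ge1Dx (- ln u); rewrite expRN lnK ?posrE //; lra.
Qed.

Lemma prime_density_integrable x :
  lebesgue_measure.-integrable `[1, x] (EFin \o prime_density).
Proof.
apply: measurable_bounded_integrable => //.
- by rewrite /= lebesgue_measure_itv /=; case: ifP => // _; rewrite -EFinB ltry.
(* Inverses are written as exp (- ln) to get a composition of measurable functions. At u = 1, where
   ln u = 0, both sides vanish through 1 - 1 / u. *)
- apply: (eq_measurable_fun (fun u => (1 - expR (- ln u)) * expR (- ln (ln u)))).
    move=> u /set_mem; rewrite /= in_itv /= => /andP[u1 _].
    have u0 : 0 < u by apply: lt_le_trans u1.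
    rewrite !expRN lnK ?posrE //.
    move: u1; rewrite le_eqVlt => /predU1P[<-|u1].
      by rewrite /prime_density invr1 subrr !mul0r.
    by rewrite lnK // posrE ln_gt0.
  have mln : measurable_fun `[1, x] (@ln R).
    by apply: measurable_funTS; exact: measurable_ln.
  apply: measurable_funM.
    apply: measurable_funB; first exact: measurable_cst.
    by apply: measurableT_comp; [exact: measurable_expR | exact: measurable_funN].
  apply: measurableT_comp; first exact: measurable_expR.
  apply: measurable_funN; apply: measurableT_comp => //; exact: measurable_ln.
- exists 1; split; first exact: num_real.
  move=> M M1 u /=; rewrite in_itv /= => /andP[u1 _].
  rewrite ger0_norm ?prime_density_ge0 //.
  by apply: le_trans (prime_density_le1 _ u1) _; apply: ltW.
Qed.

Lemma prime_integral1 : prime_integral 1 = 0.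
Proof. by rewrite /prime_integral set_itv1 Rintegral_set1. Qed.

Lemma prime_integral_increment u v c d : 1 <= u -> u <= v ->
  (forall w, u < w <= v -> c <= prime_density w <= d) ->
  (v - u) * c <= prime_integral v - prime_integral u <= (v - u) * d.
Proof.
move=> u1 uv cd.
have int := prime_density_integrable v.
have sub : `]u, v] `<=` `[1, v].
  move=> w /=; rewrite !in_itv /= => /andP[uw ->]; rewrite andbT.
  by apply: le_trans u1 (ltW uw).
have int' : lebesgue_measure.-integrable `]u, v] (EFin \o prime_density).
  by apply: integrableS int.
have -> : prime_integral v - prime_integral u =
    \int[lebesgue_measure]_(w in `]u, v]) prime_density w.
  by apply: Rintegral_itvB => //; rewrite bnd_simp.
have muE : fine (lebesgue_measure (`]u, v] : set R)) = v - u.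
  rewrite lebesgue_measure_itv /= lte_fin; case: ltP => //= vu.
  by apply/esym/eqP; rewrite subr_eq0 eq_le vu uv.
have intcst r : \int[lebesgue_measure]_(w in `]u, v]) r = (v - u) * r.
  by rewrite Rintegral_cst // muE mulrC.
have intc r : lebesgue_measure.-integrable (`]u, v] : set R) (EFin \o cst r).
  apply: measurable_bounded_integrable => //.
  - by rewrite /= lebesgue_measure_itv /=; case: ifP => // _; rewrite -EFinB ltry.
  exists `|r|; split; first exact: num_real.
  by move=> M rM w _ /=; apply: ltW.
rewrite -!intcst; apply/andP; split; apply: le_Rintegral => //; try exact: intc.
  by move=> w; rewrite /= in_itv /= => /cd /andP[].
by move=> w; rewrite /= in_itv /= => /cd /andP[].
Qed.

End PrincipalTerm.

(** * Riemann sums for the principal term *)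

Section Discretization.
Context {R : realType}.
Implicit Types (delta theta C Y : R) (k M : nat).

Lemma prime_integral_le_sub (u v : R) : 1 <= u -> u <= v ->
  0 <= prime_integral v - prime_integral u <= v - u.
Proof.
move=> u1 uv; have := prime_integral_increment u v 0 1 u1 uv.
rewrite mulr0 mulr1; apply => w /andP[uw _].
have w1 : 1 <= w by apply: le_trans u1 (ltW uw).
by rewrite prime_density_ge0 // prime_density_le1.
Qed.

Lemma prime_integral_ge_density (u v : R) : 1 <= u -> u <= v ->
  (v - u) * prime_density v <= prime_integral v - prime_integral u.
Proof.
move=> u1 uv.
suff /(prime_integral_increment _ _ _ _ u1 uv) /andP[] : forall w, u < w <= v ->
  prime_density v <= prime_density w <= 1 by [].
move=> w /andP[uw wv]; have w1 : 1 < w by apply: le_lt_trans uw.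
by rewrite prime_density_antitone //= prime_density_le1 // ltW.
Qed.

Lemma prime_integral_le_density (u v : R) : 1 < u -> u <= v ->
  prime_integral v - prime_integral u <= (v - u) * prime_density u.
Proof.
move=> u1 uv.
suff /(prime_integral_increment _ _ _ _ (ltW u1) uv) /andP[] : forall w, u < w <= v ->
  0 <= prime_density w <= prime_density u by [].
move=> w /andP[uw wv]; have w1 : 1 <= w by apply: le_trans (ltW u1) (ltW uw).
by rewrite prime_density_ge0 //= prime_density_antitone // ltW.
Qed.

Lemma expR_ge1 (x : R) : 0 <= x -> 1 <= expR x.
Proof. by move=> x0; rewrite -expR0 ler_expR. Qed.

(** Thus [log_zeta0_sum] is a Riemann sum with right endpoints and step delta for the principal
    integral in the variable ln u. *)
Lemma log_zeta0_termE delta k : 0 < delta ->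
  (expR (k.+1%:R * delta) - 1) / k.+1%:R =
  delta * expR (k.+1%:R * delta) * prime_density (expR (k.+1%:R * delta)).
Proof.
move=> d0; rewrite prime_density_exp expRN.
have e0 : expR (k.+1%:R * delta) != 0 by rewrite gt_eqF ?expR_gt0.
set E := expR _ in e0 *; field.
by rewrite ?nat1r ?natr1 pnatr_eq0 gt_eqF.
Qed.

Lemma log_zeta0_sumS delta k :
  log_zeta0_sum delta k.+1 =
  log_zeta0_sum delta k + (expR (k.+1%:R * delta) - 1) / k.+1%:R.
Proof. by rewrite /log_zeta0_sum big_ord_recr. Qed.

Lemma log_zeta0_sum_ge0 delta k : 0 <= delta -> 0 <= log_zeta0_sum delta k.
Proof.
move=> d0; apply: sumr_ge0 => i _; apply: divr_ge0 => //.
by rewrite subr_ge0 expR_ge1 // mulr_ge0.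
Qed.

Lemma one_sub_expRN_ge_sqr (x : R) : 0 <= x -> x - x ^+ 2 <= 1 - expR (- x).
Proof.
move=> x0; suff : expR (- x) <= 1 - x + x ^+ 2 by lra.
apply: le_trans (expRN_le_invD1 x x0) _.
rewrite -[leLHS]mul1r ler_pdivrMr ?ltr_pwDl //.
have -> : (1 - x + x ^+ 2) * (1 + x) = 1 + x ^+ 3 by ring.
by rewrite lerDl exprn_ge0.
Qed.

(** The density decreases, so its right endpoint values give a lower sum. Replacing delta v by v - u
    >= v (delta - delta^2) loses at most v delta^2 in each cell. *)
Lemma log_zeta0_sum_le delta k : 0 < delta ->
  log_zeta0_sum delta k <=
  prime_integral (expR (k%:R * delta)) + k%:R * delta ^+ 2 * expR (k%:R * delta).
Proof.
move=> d0; elim: k => [|k IH].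
  by rewrite /log_zeta0_sum big_ord1 !mul0r expR0 prime_integral1 subrr mul0r addr0.
rewrite log_zeta0_sumS log_zeta0_termE //.
set v := expR (k.+1%:R * delta); set u := expR (k%:R * delta) in IH *.
have kd0 : 0 <= k%:R * delta by rewrite mulr_ge0 // ltW.
have u1 : 1 <= u by apply: expR_ge1.
have vE : v * expR (- delta) = u.
  by rewrite /v /u -expRD -natr1; congr expR; ring.
have uv : u <= v by rewrite ler_expR ler_pM2r // ler_nat.
have v1 : 1 <= v by apply: le_trans uv.
have incr := prime_integral_ge_density u v u1 uv.
have h0 := prime_density_ge0 v v1; have h1 := prime_density_le1 v v1.
set h := prime_density v in incr h0 h1 *.
have vu : v * (delta - delta ^+ 2) <= v - u.
  have -> : v - u = v * (1 - expR (- delta)) by rewrite -vE mulrBr mulr1.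
  by rewrite ler_wpM2l ?expR_ge0 // one_sub_expRN_ge_sqr // ltW.
have s1 := ler_wpM2r h0 vu.
have s2 : v * delta ^+ 2 * h <= v * delta ^+ 2.
  by rewrite ler_piMr // mulr_ge0 ?expR_ge0 // sqr_ge0.
have s3 : k%:R * delta ^+ 2 * u <= k%:R * delta ^+ 2 * v.
  by rewrite ler_wpM2l // mulr_ge0 // sqr_ge0.
have e1 : v * (delta - delta ^+ 2) * h = delta * v * h - v * delta ^+ 2 * h.
  by rewrite mulrBr mulrBl [delta * v]mulrC.
rewrite e1 in s1.
have -> : k.+1%:R * delta ^+ 2 * v = k%:R * delta ^+ 2 * v + v * delta ^+ 2.
  by rewrite -natr1 !mulrDl mul1r [delta ^+ 2 * v]mulrC.
apply: le_trans (lerD IH (lexx _)) _.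
move: s1 s2 s3 incr; move: (prime_integral u) (prime_integral v) => Iu Iv.
move: (delta * v * h) (v * delta ^+ 2 * h) (v * delta ^+ 2)
  (k%:R * delta ^+ 2 * v) (k%:R * delta ^+ 2 * u) ((v - u) * h) => {IH} *; lra.
Qed.

Lemma expR_sub1_le (x : R) : expR x - 1 <= x * expR x.
Proof.
have e1 : expR x * expR (- x) = 1 by rewrite -expRD subrr expR0.
have := ler_wpM2l (expR_ge0 x) (expR_ge1Dx (- x)); rewrite e1; lra.
Qed.

(** Each cell is compared with the term at its left endpoint. The first cell starts at 1, where the
    density has the default value 0, and is bounded by its length exp delta - 1 <= delta exp
    delta. *)
Lemma prime_integral_le_sum delta k : 0 < delta ->
  prime_integral (expR (k%:R * delta)) <= expR delta * (delta + log_zeta0_sum delta k).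
Proof.
move=> d0.
have T0 j := log_zeta0_sum_ge0 delta j (ltW d0).
have main j : prime_integral (expR (j.+1%:R * delta)) <=
    expR delta * (delta + log_zeta0_sum delta j).
  elim: j => [|j IH].
    have ed1 : 1 <= expR delta by apply: expR_ge1; apply: ltW.
    have := prime_integral_le_sub 1 (expR delta) (lexx _) ed1.
    rewrite prime_integral1 subr0 mul1r => /andP[_ h].
    apply: le_trans h _; apply: le_trans (expR_sub1_le delta) _.
    by rewrite mulrC ler_wpM2l ?expR_ge0 // lerDl.
  rewrite log_zeta0_sumS log_zeta0_termE // addrA mulrDr.
  set v := expR (j.+2%:R * delta); set u := expR (j.+1%:R * delta) in IH *.
  have u1 : 1 < u by rewrite -expR0 ltr_expR mulr_gt0.
  have vE : v = u * expR delta.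
    by rewrite /v /u -expRD -[j.+2%:R]natr1; congr expR; ring.
  have uv : u <= v by rewrite ler_expR ler_pM2r // ler_nat.
  have h := prime_integral_le_density u v u1 uv.
  have h0 := prime_density_ge0 u (ltW u1); set q := prime_density u in h h0 *.
  have s : (v - u) * q <= expR delta * (delta * u * q).
    have -> : expR delta * (delta * u * q) = u * (delta * expR delta) * q by ring.
    apply: ler_wpM2r => //; have -> : v - u = u * (expR delta - 1) by rewrite vE; ring.
    by rewrite ler_wpM2l ?expR_ge0 // expR_sub1_le.
  rewrite lerBlDl in h; apply: le_trans h _; exact: lerD IH s.
case: k => [|k].
  by rewrite mul0r expR0 prime_integral1 mulr_ge0 ?expR_ge0 // addr_ge0 // ltW.
apply: le_trans (main k) _; rewrite ler_wpM2l ?expR_ge0 // lerD2l log_zeta0_sumS lerDl.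
apply: divr_ge0 => //; rewrite subr_ge0 expR_ge1 // mulr_ge0 //; exact: ltW.
Qed.

Lemma expR_le2 (x : R) : x <= 2^-1 -> expR x <= 2.
Proof.
move=> x2; rewrite -[x]opprK expRN invf_ple ?posrE ?expR_gt0 //.
by apply: le_trans (expR_ge1Dx (- x)); lra.
Qed.

(** Discretization errors up to exp Y, per unit of delta: first the excess of the integral over its
    Riemann sum, then the opposite excess together with a shift by M cells. *)
Definition mesh_loss Y M : R := 2 * (expR Y * (1 + Y) + 1) + expR Y * (Y + M%:R).

(** The discretization costs at most delta [mesh_loss] <= 1 <= exp (theta k delta), which turns C
    into C + 1. *)
Lemma discrete_error (Pi : R -> R) (S : R) delta theta C Y k M :
  0 < delta <= 2^-1 -> 0 <= theta -> 0 <= C -> delta * mesh_loss Y M <= 1 ->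
  k%:R * delta <= Y ->
  (forall w, 0 <= w -> `|Pi (expR w) - prime_integral (expR w)| <= C * expR (theta * w)) ->
  Pi (expR ((k - M)%:R * delta)) <= S <= Pi (expR (k%:R * delta)) ->
  `|S - log_zeta0_sum delta k| <= (C + 1) * expR (theta * (k%:R * delta)).
Proof.
move=> /andP[d0 d2] th0 C0 loss kY hPi /andP[Slow Sup].
set T := log_zeta0_sum delta k.
have T0 : 0 <= T by apply: log_zeta0_sum_ge0; apply: ltW.
have kd0 : 0 <= k%:R * delta by rewrite mulr_ge0 // ltW.
have kMd0 : 0 <= (k - M)%:R * delta by rewrite mulr_ge0 // ltW.
have Tle := log_zeta0_sum_le delta k d0; rewrite -/T in Tle.
have Ile := prime_integral_le_sum delta k d0; rewrite -/T in Ile.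
have P1 := hPi _ kd0; have P2 := hPi _ kMd0.
have G1 : 1 <= expR (theta * (k%:R * delta)) by apply: expR_ge1; apply: mulr_ge0.
have G2 : expR (theta * ((k - M)%:R * delta)) <= expR (theta * (k%:R * delta)).
  by rewrite ler_expR ler_wpM2l // ler_pM2r // ler_nat leq_subr.
have CG := ler_wpM2l C0 G2.
have ed2 : expR delta <= 2 by apply: expR_le2.
have edS : expR delta - 1 <= 2 * delta.
  by apply: le_trans (expR_sub1_le delta) _; rewrite mulrC ler_pM2r.
have ed1 : 1 <= expR delta by rewrite expR_ge1 // ltW.
have yE : expR ((k - M)%:R * delta) =
    expR (k%:R * delta) * expR (- ((k%:R - (k - M)%:R) * delta)).
  by rewrite -expRD; congr expR; ring.
have kM : (k%:R - (k - M)%:R : R) * delta <= M%:R * delta.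
  by rewrite ler_pM2r // lerBlDr -natrD ler_nat -leq_subLR.
have q1 := expR_ge1Dx (- ((k%:R - (k - M)%:R) * delta)).
set x := expR (k%:R * delta) in Tle Ile Sup yE P1 *.
set y := expR ((k - M)%:R * delta) in Slow yE P2 *.
have y1 : 1 <= y by apply: expR_ge1.
have yx : y <= x by rewrite ler_expR ler_pM2r // ler_nat leq_subr.
have x1 : 1 <= x by apply: expR_ge1.
have xY : x <= expR Y by rewrite ler_expR.
have /andP[_ Ix] := prime_integral_le_sub 1 x (lexx _) x1.
rewrite prime_integral1 subr0 in Ix.
have /andP[_ Ixy] := prime_integral_le_sub y x y1 yx.
have Y0 : 0 <= Y by apply: le_trans kY.
have M0 : 0 <= (M%:R : R) by [].
rewrite /mesh_loss in loss.
have E1 : 1 <= expR Y by apply: expR_ge1.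
move: (expR Y) xY E1 loss => E xY E1 loss.
move: (prime_integral x) (prime_integral y) (Pi x) (Pi y) Tle Ile P1 P2 Slow Sup Ix Ixy
  => Jx Jy px py Tle Ile P1 P2 Slow Sup Ix Ixy.
move: (expR (- ((k%:R - (k - M)%:R) * delta))) yE q1 => q yE q1.
move: (expR (theta * (k%:R * delta))) (expR (theta * ((k - M)%:R * delta))) P1 P2 G1 G2 CG
  => G G' P1 P2 G1 G2 CG.
move: (expR delta) ed1 ed2 edS Ile => ed ed1 ed2 edS Ile.
clearbody x y T.
have x0 : 0 <= x by apply: le_trans x1.
have kd2 : k%:R * delta ^+ 2 * x <= delta * (E * Y).
  have -> : k%:R * delta ^+ 2 * x = delta * (x * (k%:R * delta)) by ring.
  apply: ler_wpM2l; [exact: ltW | by apply: ler_pM].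
have xyM : x - y <= delta * (E * M%:R).
  have -> : delta * (E * M%:R) = E * (M%:R * delta) by ring.
  have -> : x - y = x * (1 - q) by rewrite yE; ring.
  apply: (@le_trans _ _ (x * (M%:R * delta))).
    by rewrite ler_wpM2l //; move: kM q1; move: (_ * delta) (M%:R * delta) => *; lra.
  by rewrite ler_wpM2r // mulr_ge0 // ltW.
have TE : T <= E * (1 + Y).
  have h : delta * (E * Y) <= E * Y.
    by rewrite ler_piMl ?mulr_ge0 //; [apply: le_trans E1 | lra].
  by rewrite mulrDr mulr1; lra.
have upT : Jx - T <= 2 * delta * (E * (1 + Y) + 1).
  have h : (ed - 1) * T <= 2 * delta * (E * (1 + Y)).
    by apply: ler_pM => //; rewrite subr_ge0.
  have h' : ed * delta <= 2 * delta by rewrite ler_pM2r.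
  by rewrite mulrDr in Ile; rewrite mulrBl mul1r in h; rewrite mulrDr mulr1; lra.
have E0 : 0 <= E by apply: le_trans E1.
have A0 : 0 <= E * (1 + Y) by rewrite mulr_ge0 // addr_ge0.
have lossE : delta * (2 * (E * (1 + Y) + 1) + E * (Y + M%:R)) =
   2 * delta * (E * (1 + Y) + 1) + (delta * (E * Y) + delta * (E * M%:R)) by ring.
rewrite lossE in loss.
have a0 : 0 <= 2 * delta * (E * (1 + Y) + 1).
  apply: mulr_ge0; first by rewrite mulr_ge0 // ltW.
  by rewrite addr_ge0.
have b0 : 0 <= delta * (E * Y) by rewrite !mulr_ge0 ?(ltW d0).
have c0 : 0 <= delta * (E * M%:R) by rewrite !mulr_ge0 ?(ltW d0).
move: P1 P2; rewrite !ler_norml mulrDl mul1r => /andP[_ P1] /andP[P2 _].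
move: (2 * delta * (E * (1 + Y) + 1)) (delta * (E * Y)) (delta * (E * M%:R))
  a0 b0 c0 upT loss xyM kd2 => A B D a0 b0 c0 upT loss xyM kd2.
move: (C * G) (C * G') CG P1 P2 => CG CG' hCG P1 P2.
move: (k%:R * delta ^+ 2 * x) kd2 Tle => kd2 hkd2 Tle.
by apply/andP; split; clear - Slow Sup Ix Ixy Tle P1 P2 hCG G1 a0 b0 c0 upT loss xyM hkd2; lra.
Qed.

End Discretization.

(** * Counting functions as finite sums *)

Section Counting.
Context {R : realType}.
Implicit Types (p : nat -> R) (x y w : R) (J L : nat).

Lemma card_fset_set_param (I : finType) (T : choiceType) (phi : I -> T)
    (S : {set I}) (A : set T) :
  injective phi -> (forall t, A t <-> exists2 i, i \in S & t = phi i) ->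
  #|` fset_set A| = #|S|.
Proof.
move=> inj AE.
have finA : finite_set A.
  have -> : A = phi @` [set` S].
    by apply/seteqP; split => t; [move/AE => [i iS ->]; exists i | case=> i iS <-;
      apply/AE; exists i].
  by apply: finite_image; apply: finite_finset.
have -> : fset_set A = imfset imfset_key phi (mem S).
  apply/fsetP => t; rewrite in_fset_set //; apply/idP/imfsetP.
    by move/set_mem/AE => [i iS ->]; exists i.
  by case=> i iS ->; apply/mem_set/AE; exists i.
rewrite card_imfset // cardE; apply/perm_size/uniq_perm.
- exact: enum_finmem_uniq.
- exact: enum_uniq.
- by move=> i; rewrite !enum_finmemE.
Qed.

Lemma beurling_prime_gt1 p j : beurling_primes p -> 1 < p j.
Proof.
by case=> p0 ndp _; apply: lt_le_trans p0 _; apply: ndp.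
Qed.

Lemma beurling_primes_eventually_gt p x : beurling_primes p ->
  exists J, forall j, (J <= j)%N -> x < p j.
Proof.
case=> _ ndp unb; apply: contrapT => none; apply: unb; exists x => _ [j _ <-].
rewrite leNgt; apply/negP => xj; apply: none; exists j => i ji.
by apply: lt_le_trans xj _; apply: ndp.
Qed.

Lemma prime_count_sum p x J : (forall j, (J <= j)%N -> x < p j) ->
  prime_count p x = (\sum_(j < J) (p j <= x)%R)%N.
Proof.
move=> pJ; rewrite /prime_count.
rewrite (card_fset_set_param _ _ (@nat_of_ord J) [set j : 'I_J | p j <= x]%SET).
- by rewrite -sum1_card big_mkcond; apply: eq_bigr => j _; rewrite inE; case: ifP.
- exact: ord_inj.
move=> j /=; split=> [jx|[i]]; last by rewrite inE => ix ->.
have jJ : (j < J)%N by rewrite ltnNge; apply/negP => /pJ; rewrite ltNge jx.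
by exists (Ordinal jJ); rewrite ?inE.
Qed.

(** Exchange the sums over primes and exponents: p_j is at most exp (w / m) exactly when m <= w / ln
    (p_j). The series is a finite sum, as its terms vanish for large m. *)
Lemma riemann_count_exp p w J : beurling_primes p -> 0 <= w ->
  (forall j, (J <= j)%N -> expR w < p j) ->
  riemann_count p (expR w) =
  \sum_(j < J) harmonic_sum (Num.truncn (w / ln (p j))).
Proof.
move=> hp w0 pJ; rewrite /riemann_count.
have lnp j : 0 < ln (p j) by rewrite ln_gt0 // beurling_prime_gt1.
pose t j := Num.truncn (w / ln (p j)).
have termE m : (0 < m)%N ->
    prime_count p (expR w `^ m%:R^-1) = (\sum_(j < J) (m <= t j)%N)%N.
  move=> m0; have mR : 0 < (m%:R : R) by rewrite ltr0n.
  have le1 : w * m%:R^-1 <= w by rewrite ler_piMr // invf_le1 // ler1n.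
  rewrite -expRM (prime_count_sum _ _ J); last first.
    by move=> j /pJ; apply: le_lt_trans; rewrite ler_expR.
  apply: eq_bigr => j _; congr nat_of_bool.
  have p0 : 0 < p j by apply: lt_trans (beurling_prime_gt1 p j hp).
  rewrite truncn_ge_nat ?divr_ge0 ?(ltW (lnp j)) // ler_pdivlMr //.
  by rewrite -[p j in LHS]lnK ?posrE // ler_expR ler_pdivlMr // mulrC.
have harmE n k : (k <= n)%N ->
    \sum_(1 <= m < n.+1) m%:R^-1 * (m <= k)%N%:R = harmonic_sum k :> R.
  move=> kn; rewrite /harmonic_sum big_add1 /= (@big_cat_nat _ _ _ k) //=.
  rewrite [X in _ + X]big1_seq ?addr0 ?big_mkord => [|i].
    by apply: eq_bigr => i _; rewrite ltn_ord mulr1.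
  by rewrite mem_index_iota => /= /andP[ki _]; rewrite ltnNge ki mulr0.
apply: lim_near_cst; first exact: Rhausdorff.
exists (\max_(j < J) t j).+1 => // -[//|n] /= tn.
rewrite (eq_big_nat _ _ (F2 := fun m => \sum_(j < J) m%:R^-1 * (m <= t j)%N%:R)).
  rewrite exchange_big /=; apply: eq_bigr => j _; apply: harmE.
  by rewrite -ltnS; apply: leq_ltn_trans tn; apply: leq_bigmax.
by move=> m /andP[m0 _]; rewrite termE // natr_sum mulr_sumr.
Qed.

Definition fsfun_of_ord J L (f : {ffun 'I_J -> 'I_L.+1}) : {fsfun nat -> nat with 0%N} :=
  [fsfun x in seq_fset tt (iota 0 J) =>
     oapp (fun i : 'I_J => nat_of_ord (f i)) 0%N (insub x) | 0%N].

Lemma fsfun_of_ordE J L (f : {ffun 'I_J -> 'I_L.+1}) (i : 'I_J) :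
  fsfun_of_ord J L f i = f i.
Proof.
have iE : insub (nat_of_ord i) = Some i by exact: valK.
by rewrite fsfunE seq_fsetE mem_iota ltn_ord iE.
Qed.

Lemma fsfun_of_ord_out J L (f : {ffun 'I_J -> 'I_L.+1}) j :
  (J <= j)%N -> fsfun_of_ord J L f j = 0%N.
Proof. by move=> Jj; rewrite fsfunE seq_fsetE mem_iota /= add0n ltnNge Jj. Qed.

Lemma gen_integer_ord p (e : {fsfun nat -> nat with 0%N}) J :
  (forall j, (J <= j)%N -> e j = 0%N) ->
  gen_integer p e = \prod_(j < J) p j ^+ e j.
Proof.
move=> eJ; rewrite /gen_integer -(big_mkord xpredT (fun j => p j ^+ e j)).
rewrite [RHS](bigID (fun j => e j != 0%N)) /= [X in _ * X]big1 ?mulr1; last first.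
  by move=> j; rewrite negbK => /eqP ->; rewrite expr0.
rewrite -[RHS]big_filter; apply: perm_big; apply: uniq_perm.
- exact: fset_uniq.
- by rewrite filter_uniq // iota_uniq.
move=> j; rewrite mem_filter mem_index_iota mem_finsupp /=.
case ej : (e j == 0%N) => //=; rewrite ltnNge; apply/esym/negP => /eJ e0.
by rewrite e0 in ej.
Qed.

(** Each prime power in a generalized integer up to exp y is itself at most exp y, since the other
    factors are at least 1. This bounds both the indices and the exponents. *)
Lemma integer_count_card p y J L : beurling_primes p ->
  (forall j, (J <= j)%N -> expR y < p j) -> y < L.+1%:R * ln (p 0%N) ->
  integer_count p (expR y) =
  #|[set f : {ffun 'I_J -> 'I_L.+1} | \sum_(j < J) (f j)%:R * ln (p j) <= y]%SET|.
Proof.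
move=> hp pJ yL; rewrite /integer_count.
have p1 j := beurling_prime_gt1 p j hp.
have p0 j : 0 < p j by apply: lt_trans (p1 j).
have pexp j n : p j ^+ n = expR (n%:R * ln (p j)) by rewrite expRM_natl lnK ?posrE.
apply: (card_fset_set_param _ _ (fsfun_of_ord J L)).
  move=> f g fg; apply/ffunP => i; apply: val_inj => /=.
  by rewrite -!fsfun_of_ordE fg.
have genE f : (gen_integer p (fsfun_of_ord J L f) <= expR y) =
    (\sum_(j < J) (f j)%:R * ln (p j) <= y).
  rewrite (gen_integer_ord p _ J); last by move=> j; apply: fsfun_of_ord_out.
  rewrite (eq_bigr (fun j : 'I_J => expR ((f j)%:R * ln (p j)))); last first.
    by move=> j _; rewrite fsfun_of_ordE pexp.
  by rewrite -expR_sum ler_expR.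
move=> e /=; split=> [eA|[f]]; last by rewrite inE => fy ->; rewrite genE.
have pe j : e j != 0%N -> p j ^+ e j <= expR y.
  move=> ej; apply: le_trans eA; rewrite /gen_integer.
  have je : j \in finsupp e by rewrite mem_finsupp.
  rewrite (big_rem j) //= ler_peMr ?exprn_ge0 ?(ltW (p0 j)) //.
  by apply: (big_ind (fun z => 1 <= z)) => // [a b a1 b1|i _];
    [apply: mulr_ege1 | apply: exprn_ege1; apply: ltW].
have eJ j : (J <= j)%N -> e j = 0%N.
  move=> Jj; apply/eqP/negPn/negP => ej; have := pe j ej.
  apply/negP; rewrite -ltNge; apply: lt_le_trans (pJ j Jj) _.
  by rewrite -[leLHS]expr1 ler_eXn2l // lt0n.
have eL j : (e j < L.+1)%N.
  have [->//|ej] := eqVneq (e j) 0%N; have := pe j ej.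
  rewrite pexp ler_expR => h; rewrite -(ltr_nat R).
  have l0 : 0 < ln (p 0%N) by rewrite ln_gt0.
  rewrite -(ltr_pM2r l0); apply: le_lt_trans yL; apply: le_trans h.
  rewrite ler_wpM2l // ler_ln ?posrE //; case: hp => _ ndp _; exact: ndp.
pose f : {ffun 'I_J -> 'I_L.+1} := [ffun j => Ordinal (eL (val j))].
have ef : e = fsfun_of_ord J L f.
  apply/fsfunP => j; have [jJ|Jj] := ltnP j J.
    by rewrite (fsfun_of_ordE J L f (Ordinal jJ)) ffunE.
  by rewrite fsfun_of_ord_out // eJ.
by exists f => //; rewrite inE -genE -ef.
Qed.

End Counting.

(** * Rounding the logarithms of the primes *)

Section Mesh.
Context {R : realType}.
Implicit Types (p : nat -> R) (delta y Y : R) (J L M k n : nat).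

(* Rounding up, by at most delta, the logarithms of the primes to multiples of
   delta turns the generalized integers into a power series in one variable. *)
Definition mesh_index p delta (j : nat) : nat := (Num.truncn (ln (p j) / delta)).+1.

Lemma mesh_index_bounds p delta j : beurling_primes p -> 0 < delta ->
  ln (p j) <= (mesh_index p delta j)%:R * delta <= ln (p j) + delta.
Proof.
move=> hp d0.
have q0 : 0 <= ln (p j) / delta.
  by rewrite divr_ge0 ?(ltW d0) // ln_ge0 // ltW // beurling_prime_gt1.
have /andP[h1 h2] := Num.Theory.truncn_itv q0.
rewrite /mesh_index; apply/andP; split.
  by rewrite -ler_pdivrMr // ltW.
by rewrite -natr1 mulrDl mul1r lerD2r -ler_pdivlMr.
Qed.

Lemma ln_prime_gt0 p j : beurling_primes p -> 0 < ln (p j).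
Proof. by move=> hp; rewrite ln_gt0 // beurling_prime_gt1. Qed.

Lemma le_ln_prime0 p j : beurling_primes p -> ln (p 0%N) <= ln (p j).
Proof.
move=> hp; have p1 i := beurling_prime_gt1 p i hp.
rewrite ler_ln ?posrE; [|exact: lt_trans (p1 _)..].
by case: hp => _ ndp _; apply: ndp.
Qed.

Lemma le_harmonic_sum m n : (m <= n)%N -> harmonic_sum m <= harmonic_sum n :> R.
Proof.
move=> mn; rewrite /harmonic_sum -(subnKC mn) big_split_ord /= lerDl.
by apply: sumr_ge0 => i _; rewrite invr_ge0.
Qed.

(** Rounding up can only lose prime powers. Conversely, an n-th power up to exp Y has n <= M, so its
    logarithm moves by at most M delta. *)
Lemma riemann_count_mesh p delta Y J M k : beurling_primes p -> 0 < delta ->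
  k%:R * delta <= Y -> (forall j, (J <= j)%N -> expR Y < p j) ->
  Y < M.+1%:R * ln (p 0%N) ->
  riemann_count p (expR ((k - M)%:R * delta)) <=
    \sum_(j < J) harmonic_sum (k %/ mesh_index p delta j)
    <= riemann_count p (expR (k%:R * delta)).
Proof.
move=> hp d0 kY pJ YM.
have lp j := ln_prime_gt0 p j hp.
have kd0 i : 0 <= i%:R * delta by rewrite mulr_ge0 // ltW.
have kM : (k - M)%:R * delta <= k%:R * delta by rewrite ler_pM2r // ler_nat leq_subr.
rewrite !(riemann_count_exp _ _ J) //; last 2 first.
- by move=> j /pJ; apply: le_lt_trans; rewrite ler_expR.
- by move=> j /pJ; apply: le_lt_trans; rewrite ler_expR (le_trans kM).
apply/andP; split; apply: ler_sum => j _; apply: le_harmonic_sum.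
  have /andP[_ aj] := mesh_index_bounds p delta j hp d0.
  set n := Num.truncn _; rewrite leq_divRL //.
  have nw : n%:R * ln (p j) <= (k - M)%:R * delta.
    by rewrite -ler_pdivlMr // Num.Theory.truncn_le divr_ge0 // ltW.
  have nM : (n <= M)%N.
    rewrite -ltnS -(ltr_nat R) -(ltr_pM2r (lp 0%N)); apply: le_lt_trans YM.
    apply: le_trans kY; apply: le_trans kM; apply: le_trans nw.
    by rewrite ler_wpM2l // le_ln_prime0.
  have na : (n * mesh_index p delta j <= (k - M) + n)%N.
    rewrite -(ler_nat R) natrM natrD -(ler_pM2r d0) -mulrA.
    apply: le_trans (ler_wpM2l (ler0n _ _) aj) _.
    by rewrite mulrDr mulrDl lerD2r.
  (* If k <= M, the truncated subtraction gives 0 and there is no power to count. *)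
  have [kM'|Mk] := leqP k M.
    have -> : n = 0%N.
      rewrite /n (_ : (k - M)%:R = 0); last by apply/eqP; rewrite pnatr_eq0 subn_eq0.
      by rewrite mul0r mul0r Num.Theory.truncn0.
    by [].
  by apply: leq_trans na _; rewrite -[leqRHS](subnK (ltnW Mk)) leq_add2l.
have /andP[aj _] := mesh_index_bounds p delta j hp d0.
rewrite Num.Theory.truncn_ge_nat ?divr_ge0 ?(ltW (lp j)) // ler_pdivlMr //.
apply: le_trans (ler_wpM2l (ler0n _ _) aj) _.
by rewrite mulrA -natrM ler_pM2r // ler_nat leq_divM.
Qed.

Definition mesh_count p delta J L (n : nat) : nat :=
  #|[set e : {ffun 'I_J -> 'I_L.+1} |
       (weighted_sum (fun j : 'I_J => mesh_index p delta j) e <= n)%N]%SET|.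

(** A generalized integer up to exp y has at most M prime factors, so rounding adds at most M delta
    to its logarithm, and y < (n + 1) delta. *)
Lemma integer_count_mesh p delta y J L M n : beurling_primes p -> 0 < delta ->
  n%:R * delta <= y < n.+1%:R * delta ->
  (forall j, (J <= j)%N -> expR y < p j) ->
  y < M.+1%:R * ln (p 0%N) -> (M <= L)%N ->
  (mesh_count p delta J L n <= integer_count p (expR y) <=
   mesh_count p delta J L (n.+1 + M))%N.
Proof.
move=> hp d0 /andP[ny yn] pJ yM ML.
have lp j := ln_prime_gt0 p j hp.
rewrite (integer_count_card _ _ J L) //; last first.
  by apply: lt_le_trans yM _; rewrite ler_pM2r // ler_nat.
have wE (e : {ffun 'I_J -> 'I_L.+1}) :
    (weighted_sum (fun j : 'I_J => mesh_index p delta j) e)%:R * delta =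
    \sum_(j < J) (e j)%:R * ((mesh_index p delta j)%:R * delta).
  by rewrite natr_sum mulr_suml; apply: eq_bigr => j _; rewrite natrM mulrA.
apply/andP; split; apply/subset_leq_card/fintype.subsetP => e; rewrite !inE => he.
  apply: le_trans ny; apply: (@le_trans _ _
    ((weighted_sum (fun j : 'I_J => mesh_index p delta j) e)%:R * delta)).
    rewrite wE; apply: ler_sum => j _; rewrite ler_wpM2l //.
    by case/andP: (mesh_index_bounds p delta j hp d0).
  by rewrite ler_pM2r // ler_nat.
have sM : (\sum_(j < J) e j <= M)%N.
  rewrite -ltnS -(ltr_nat R) -(ltr_pM2r (lp 0%N)); apply: le_lt_trans yM.
  apply: le_trans he; rewrite natr_sum mulr_suml; apply: ler_sum => j _.
  by rewrite ler_wpM2l // le_ln_prime0.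
rewrite -ltnS -addSn -(ltr_nat R) -(ltr_pM2r d0) wE.
apply: (@le_lt_trans _ _ (y + (\sum_(j < J) e j)%N%:R * delta)).
  rewrite natr_sum mulr_suml; apply: le_trans (lerD he (lexx _)).
  rewrite -big_split; apply: ler_sum => j _ /=; rewrite -mulrDr ler_wpM2l //.
  by case/andP: (mesh_index_bounds p delta j hp d0).
apply: (@lt_le_trans _ _ (n.+1%:R * delta + M%:R * delta)).
  by rewrite ltr_leD // ler_pM2r // ler_nat.
by rewrite -mulrDl -natrD ler_pM2r // ler_nat leq_add2r.
Qed.

End Mesh.

(** * Approximation of N(x) / x *)

Section Approximation.
Context {R : realType}.
Implicit Types (p : nat -> R) (delta alpha theta y Y C lam eta : R).

(** The exponential factor of [psum_exp_poly_close] with V = C + 4 ln (2 + y), where 2 + y bounds 1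
    + K delta for the cutoffs K delta <= y + 1. *)
Definition error_term alpha C lam y : R :=
  expR (- (2 * Num.sqrt (alpha * lam * y)) + lam + expR lam * (C + 4 * ln (2 + y))).

Lemma error_term_ge0 alpha C lam y : 0 <= error_term alpha C lam y.
Proof. exact: expR_ge0. Qed.

Lemma error_term_mono alpha C C' lam y : C <= C' ->
  error_term alpha C lam y <= error_term alpha C' lam y.
Proof. by move=> CC'; rewrite ler_expR lerD2l ler_wpM2l ?expR_ge0 // lerD2r. Qed.

Lemma expRN_le_error_term alpha C lam y :
  0 <= alpha -> 0 <= lam -> 0 <= C -> 0 <= y ->
  expR (- (alpha * y)) <= error_term alpha C lam y.
Proof.
move=> a0 l0 C0 y0; have := amgm_decay alpha lam y 0 a0 l0 y0.
rewrite divr1 expr1 -expRD => /le_trans; apply; rewrite ler_expR lerDl.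
apply: mulr_ge0; first exact: expR_ge0.
by apply: addr_ge0 => //; apply: mulr_ge0 => //; apply: ln_ge0; lra.
Qed.

Lemma dist_expR_le (a b c : R) : a <= c -> b <= c ->
  `|expR a - expR b| <= expR c * `|a - b|.
Proof.
have aux u v : u <= c -> v <= u -> expR u - expR v <= expR c * (u - v).
  move=> uc vu; have -> : expR u - expR v = expR u * (1 - expR (- (u - v))).
    by rewrite mulrBr mulr1 -expRD; congr (_ - expR _); ring.
  apply: ler_pM; rewrite ?expR_ge0 ?ler_expR // ?subr_ge0.
    by rewrite -expR0 ler_expR oppr_le0 subr_ge0.
  by have := expR_ge1Dx (- (u - v)); lra.
move=> ac bc; have [ab|/ltW ba] := leP a b.
  by rewrite (distrC (expR a)) (distrC a) !ger0_norm ?subr_ge0 ?ler_expR //; apply: aux.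
by rewrite !ger0_norm ?subr_ge0 ?ler_expR //; apply: aux.
Qed.

(** The mass up to K is replaced by the mass up to L, which is the same for all cutoffs K. The
    change is a tail beyond K, controlled by [expRN_le_error_term]. *)
Lemma log_ratio_exp_bound {J : nat} (L K : nat) delta alpha C lam y (a : 'I_J -> nat) :
  0 < delta <= 2^-1 -> 0 < alpha <= 1 -> 0 <= C -> (forall j, 0 < a j)%N ->
  (forall k, (k <= L)%N ->
     `|\sum_(j < J) harmonic_sum (k %/ a j) - log_zeta0_sum delta k| <=
     C * expR ((1 - alpha) * (k%:R * delta))) ->
  0 <= lam -> (K <= L)%N -> 0 <= y <= K.+1%:R * delta -> K%:R * delta <= y + 1 ->
  let C2 := C * (2 + 2 / alpha) in
  let f := log_ratio L (expR (- delta)) a in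
  `|psum K (exp_poly L f) - expR (psum L f)| <=
    (4 * C2 + 2 * C2 * expR C2) * error_term alpha C2 lam y.
Proof.
move=> /andP[d0 d2] al C0 a0 hE l0 KL yK Ky; cbv zeta.
set C2 := C * (2 + 2 / alpha); set f := log_ratio L (expR (- delta)) a.
have d1 : delta <= 1 by lra.
have /andP[al0 al1] := al; have /andP[y0 yK'] := yK.
have d01 : 0 < delta <= 1 by rewrite d0.
have [tail nrm] := log_ratio_bounds L delta alpha C a d01 al C0 a0 hE.
rewrite -/f -/C2 in tail nrm.
have C20 : 0 <= C2.
  by apply: mulr_ge0 => //; apply: addr_ge0 => //; apply: divr_ge0 => //; apply: ltW.
have Kd0 : 0 <= K%:R * delta by apply: mulr_ge0 => //; apply: ltW.
have V : pnorm K f <= C2 + 4 * ln (2 + y).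
  apply: le_trans (nrm K KL) _; rewrite lerD2l ler_pM2l // ler_ln ?posrE; lra.
have tailK z w : (z <= w <= K)%N ->
    `|psum w f - psum z f| <= C2 * expR (- (alpha * delta * z%:R)).
  by move=> /andP[zw wK]; apply: tail; rewrite zw (leq_trans wK).
have f0 : f`_0 = 0 by apply: coef0_log_ratio.
have main := psum_exp_poly_close f L K C2 _ alpha lam delta y KL f0 d0 (ltW al0) l0 C20
  yK V tailK.
rewrite -/(error_term _ _ _ _) in main.
have ed2 : expR (alpha * delta) <= 2.
  by apply: expR_le2; apply: le_trans d2; rewrite ler_piMl // ltW.
have E0 := error_term_ge0 alpha C2 lam y.
have m1 : `|psum K (exp_poly L f) - expR (psum K f)| <= 4 * C2 * error_term alpha C2 lam y.
  apply: le_trans main _; apply: ler_wpM2r => //.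
  have -> : 4 * C2 = 2 * C2 * 2 by ring.
  by apply: ler_wpM2l => //; apply: mulr_ge0.
have Fle w : (w <= L)%N -> psum w f <= C2.
  move=> wL; have := tail 0%N w wL.
  rewrite [psum 0 f]big_ord1 f0 subr0 mulr0 oppr0 expR0 mulr1.
  by apply: le_trans; apply: ler_norm.
have m2 : `|expR (psum K f) - expR (psum L f)| <=
    2 * C2 * expR C2 * error_term alpha C2 lam y.
  apply: le_trans (dist_expR_le _ _ C2 (Fle _ KL) (Fle _ (leqnn L))) _.
  rewrite distrC; have KLL : (K <= L <= L)%N by rewrite KL leqnn.
  have := tail K L KLL.
  have dec : expR (- (alpha * delta * K%:R)) <= 2 * error_term alpha C2 lam y.
    apply: (@le_trans _ _ (expR (alpha * delta) * expR (- (alpha * y)))).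
      rewrite -expRD ler_expR -natr1 in yK' *.
      have := ler_wpM2l (ltW al0) yK'.
      have -> : alpha * ((K%:R + 1) * delta) = alpha * delta * K%:R + alpha * delta by ring.
      by move: (alpha * delta * K%:R) (alpha * delta) (alpha * y) => u v w h;
        clear - h; lra.
    by apply: ler_pM; rewrite ?expR_ge0 // expRN_le_error_term // ltW.
  move=> h; have -> : 2 * C2 * expR C2 * error_term alpha C2 lam y =
    expR C2 * (C2 * (2 * error_term alpha C2 lam y)) by ring.
  apply: ler_wpM2l; first exact: expR_ge0.
  by apply: le_trans h _; apply: ler_wpM2l.
rewrite mulrDl.
have -> : psum K (exp_poly L f) - expR (psum L f) =
  (psum K (exp_poly L f) - expR (psum K f)) + (expR (psum K f) - expR (psum L f)).
  by rewrite addrA subrK.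
by apply: le_trans (ler_normD _ _) _; apply: lerD.
Qed.

Lemma small_mesh (a b c : R) : 0 <= a -> 0 <= b -> 0 <= c ->
  exists2 delta, 0 < delta <= 2^-1 & [/\ delta * a <= 1, delta * b <= 2^-1 & delta * c <= 1].
Proof.
move=> a0 b0 c0; have A0 : 0 < 2 + a + 2 * b + c by lra.
exists (2 + a + 2 * b + c)^-1.
  rewrite invr_gt0 A0 lef_pV2 ?posrE //; lra.
split; rewrite mulrC ler_pdivrMr //; lra.
Qed.

(* Phi depends on Y and eta only: a single mesh serves all y in [0, Y], and eta
   absorbs its discretization error. *)
Lemma integer_count_approx p theta C0 : beurling_primes p ->
  0 <= theta -> theta < 1 -> 0 <= C0 ->
  (forall w, 0 <= w -> `|riemann_count p (expR w) - prime_integral (expR w)|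
     <= C0 * expR (theta * w)) ->
  exists2 C, 0 <= C &
  forall Y eta, 0 <= Y -> 0 < eta -> exists2 Phi, `|Phi| <= C &
  forall y lam, 0 <= y <= Y -> 0 <= lam ->
    `|(integer_count p (expR y))%:R * expR (- y) - expR Phi| <=
    C * error_term (1 - theta) C lam y + eta.
Proof.
move=> hp th0 th1 C00 hPi; set alpha := 1 - theta.
have al : 0 < alpha <= 1 by rewrite /alpha subr_gt0 th1 lerBlDr lerDl.
have /andP[al0 al1] := al.
set C1 := C0 + 1; set C2 := C1 * (2 + 2 / alpha).
set B := 4 * C2 + 2 * C2 * expR C2.
have C10 : 0 <= C1 by rewrite addr_ge0.
have C20 : 0 <= C2.
  by apply: mulr_ge0 => //; apply: addr_ge0 => //; apply: divr_ge0 => //; apply: ltW.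
have B1 : 0 <= 2 * C2 * expR C2.
  by apply: mulr_ge0; [apply: mulr_ge0 | exact: expR_ge0].
have B0 : 0 <= B by rewrite /B addr_ge0 // mulr_ge0.
have CC : C2 <= 2 * B by rewrite /B; move: B1; move: (2 * C2 * expR C2) => t t0; lra.
exists (2 * B); first by rewrite mulr_ge0.
move=> Y eta Y0 eta0.
have lp0 := ln_prime_gt0 p 0 hp.
(* At most M prime factors occur up to exp (Y + 1); the extra 1 leaves room for mesh cutoffs beyond
   y. *)
set M := Num.truncn ((Y + 1) / ln (p 0%N)).
have YM : Y + 1 < M.+1%:R * ln (p 0%N).
  rewrite -ltr_pdivrMr //; exact: Num.Theory.truncnS_gt.
have loss0 : 0 <= mesh_loss (Y + 1) M.
  rewrite /mesh_loss; have := expR_ge0 (Y + 1); move: (expR (Y + 1)) => E E0.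
  have M0 := ler0n R M; apply: addr_ge0.
    by apply: mulr_ge0 => //; apply: addr_ge0 => //; apply: mulr_ge0 => //; lra.
  by apply: mulr_ge0 => //; lra.
have eC0 : 0 <= 2 * M.+1%:R * expR C2 / eta.
  by apply: divr_ge0; [rewrite !mulr_ge0 ?expR_ge0 // | exact: ltW].
(* The three conditions serve [discrete_error], cutoffs within 1/2 above y, and the final error
   eta. *)
have [delta d02 [dloss dM deta]] :=
  small_mesh (mesh_loss (Y + 1) M) M.+1%:R _ loss0 (ler0n R _) eC0.
have /andP[d0 d2] := d02.
have [J pJ] := beurling_primes_eventually_gt p (expR (Y + 1)) hp.
(* The upper cutoff of [integer_count_mesh] at y = Y, the largest degree that occurs. *)
set L := ((Num.truncn (Y / delta)).+1 + M)%N.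
have Ld : L%:R * delta <= Y + 1.
  rewrite /L addSnnS natrD mulrDl; apply: lerD; last by rewrite mulrC (le_trans dM) //; lra.
  by rewrite -ler_pdivlMr // Num.Theory.truncn_le divr_ge0 // ltW.
pose a (j : 'I_J) := mesh_index p delta j.
have a0 j : (0 < a j)%N by [].
have hE k : (k <= L)%N -> `|\sum_(j < J) harmonic_sum (k %/ a j) - log_zeta0_sum delta k|
    <= C1 * expR ((1 - alpha) * (k%:R * delta)).
  move=> kL; have -> : 1 - alpha = theta by rewrite /alpha opprB addrC subrK.
  have kY : k%:R * delta <= Y + 1.
    by apply: le_trans Ld; rewrite ler_pM2r // ler_nat.
  apply: (discrete_error (riemann_count p) _ _ _ _ (Y + 1) _ M) => //.
  exact: riemann_count_mesh kY pJ YM.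
set f := log_ratio L (expR (- delta)) a.
exists (psum L f).
  have d01 : 0 < delta <= 1 by rewrite d0 /=; lra.
  have [tail _] := log_ratio_bounds L delta alpha C1 a d01 al C10 a0 hE.
  have := tail 0%N L; rewrite -/f leqnn => /(_ isT).
  rewrite [psum 0 f]big_ord1 coef0_log_ratio subr0 mulr0 oppr0 expR0 mulr1 -/C2.
  by move=> h; apply: le_trans h CC.
have PhiC2 : psum L f <= C2.
  have d01 : 0 < delta <= 1 by rewrite d0 /=; lra.
  have [tail _] := log_ratio_bounds L delta alpha C1 a d01 al C10 a0 hE.
  have := tail 0%N L; rewrite -/f leqnn => /(_ isT).
  rewrite [psum 0 f]big_ord1 coef0_log_ratio subr0 mulr0 oppr0 expR0 mulr1 -/C2.
  by apply: le_trans; apply: ler_norm.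
move=> y lam /andP[y0 yY] l0.
set n := Num.truncn (y / delta).
have yd0 : 0 <= y / delta by rewrite divr_ge0 // ltW.
have /andP[ny yn] : n%:R * delta <= y < n.+1%:R * delta.
  by rewrite -ler_pdivlMr // -ltr_pdivrMr //; apply: Num.Theory.truncn_itv.
have nL : (n.+1 + M <= L)%N.
  by rewrite leq_add2r ltnS Num.Theory.le_truncn // ler_pM2r // invr_gt0.
have nL' : (n <= L)%N by apply: leq_trans nL; rewrite addSn ltnW // ltnS leq_addr.
have ML : (M <= L)%N by apply: leq_addl.
have yM : y < M.+1%:R * ln (p 0%N) by apply: le_lt_trans YM; lra.
have pJy j : (J <= j)%N -> expR y < p j.
  by move/pJ; apply: le_lt_trans; rewrite ler_expR; lra.
have nyn : n%:R * delta <= y < n.+1%:R * delta by rewrite ny.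
have /andP[Nlow Nup] := integer_count_mesh p delta y J L M n hp d0 nyn pJy yM ML.
have Kd : (n.+1 + M)%:R * delta - y <= delta * M.+1%:R.
  rewrite lerBlDl addSnnS natrD mulrDl; apply: lerD => //.
  by rewrite mulrC.
set X := error_term alpha C2 lam y.
have SE K : (K <= L)%N -> psum K (exp_poly L f) =
    expR (- delta) ^+ K * (mesh_count p delta J L K)%:R.
  by move=> KL; apply: psum_exp_log_ratio.
have b1 : `|psum n (exp_poly L f) - expR (psum L f)| <= B * X.
  apply: (log_ratio_exp_bound L n delta alpha C1 lam y a) => //.
    by rewrite y0 ltW.
  by apply: le_trans ny _; rewrite lerDl.
have b2 : `|psum (n.+1 + M) (exp_poly L f) - expR (psum L f)| <= B * X.
  apply: (log_ratio_exp_bound L (n.+1 + M) delta alpha C1 lam y a) => //.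
    rewrite y0 ltW //; apply: lt_le_trans yn _.
    by rewrite ler_pM2r // ler_nat addSn ltnS leqW // leq_addr.
  by rewrite -lerBlDl; apply: le_trans Kd _; apply: le_trans dM _; lra.
rewrite SE // in b1; rewrite SE // in b2.
have sE K : expR (- delta) ^+ K = expR (- (K%:R * delta)) by rewrite -expRM_natl mulrN.
rewrite sE in b1; rewrite sE in b2.
have XX : X <= error_term alpha (2 * B) lam y by apply: error_term_mono.
have BX0 : 0 <= B * X by rewrite mulr_ge0 // error_term_ge0.
have BX : 2 * (B * X) <= 2 * B * error_term alpha (2 * B) lam y.
  by rewrite mulrA; apply: ler_wpM2l => //; rewrite mulr_ge0.
move: (error_term _ (2 * B) _ _) BX => Z BX {XX}.
have ePhi : expR (psum L f) <= expR C2 by rewrite ler_expR.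
have ePhi0 := expR_ge0 (psum L f).
have etaE : 2 * (delta * M.+1%:R) * expR C2 <= eta.
  have h : delta * (2 * M.+1%:R * expR C2 / eta) * eta <= 1 * eta by rewrite ler_pM2r.
  rewrite mul1r in h; apply: le_trans h; rewrite le_eqVlt; apply/orP; left; apply/eqP.
  by field; rewrite gt_eqF.
(* Both cutoffs lie within tau of y, so exchanging exp (- y) for the mesh weights changes the main
   term by at most 2 tau exp C2 <= eta. *)
set tau := delta * M.+1%:R in Kd dM etaE.
have tau0 : 0 <= tau by rewrite mulr_ge0 // ltW.
have dtau : delta <= tau by rewrite /tau ler_peMr ?(ltW d0) // ler1n.
have etau2 : expR tau <= 2 by apply: expR_le2.
have etau : expR tau - 1 <= 2 * tau.
  by apply: le_trans (expR_sub1_le tau) _; rewrite mulrC ler_wpM2r.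
have etau1 : 1 <= expR tau by apply: expR_ge1.
set N := integer_count p (expR y) in Nlow Nup *.
have up : N%:R * expR (- y) <= expR tau *
    (expR (- ((n.+1 + M)%:R * delta)) * (mesh_count p delta J L (n.+1 + M))%:R).
  rewrite mulrA -expRD mulrC; apply: ler_pM; rewrite ?expR_ge0 ?ler_nat //.
  by rewrite ler_expR; move: Kd; move: (_ * delta) => u h; clear - h; lra.
have low : expR (- delta) * (expR (- (n%:R * delta)) * (mesh_count p delta J L n)%:R)
    <= N%:R * expR (- y).
  rewrite mulrA -expRD [leRHS]mulrC; apply: ler_pM; rewrite ?expR_ge0 ?ler_nat //.
  rewrite ler_expR -natr1 mulrDl mul1r in yn *; clear - yn.
  by move: (_ * delta) yn => u h; lra.
have ed := expR_ge1Dx (- delta).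
have ed1 : expR (- delta) <= 1 by rewrite -expR0 ler_expR oppr_le0 ltW.
have ed0 := expR_ge0 (- delta).
have S0 : 0 <= expR (- (n%:R * delta)) * (mesh_count p delta J L n)%:R.
  by rewrite mulr_ge0 ?expR_ge0 //.
move: (N%:R * expR (- y)) (expR (- (n%:R * delta)) * (mesh_count p delta J L n)%:R)
  (expR (- ((n.+1 + M)%:R * delta)) * (mesh_count p delta J L (n.+1 + M))%:R)
  up low b1 b2 S0 => Nx S1 S2 up low b1 b2 S0.
move: (expR (psum L f)) (expR C2) ePhi ePhi0 b1 b2 etaE => P E PE P0 b1 b2 etaE.
move: (expR tau) (expR (- delta)) etau1 etau2 etau up ed ed1 ed0 low
  => T D T1 T2 T3 up D1 D2 D3 low.
move: (B * X) (2 * B * Z) b1 b2 BX BX0 => W V b1 b2 WV W0.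
move: b1 b2; rewrite !ler_distl => /andP[b1 _] /andP[_ b2].
have u1 : T * S2 <= T * (P + W) by apply: ler_wpM2l => //; clear - b2 T1; lra.
have u2 : T * (P + W) <= P + 2 * tau * E + 2 * W.
  have h1 : (T - 1) * P <= 2 * tau * E by apply: ler_pM => //; lra.
  have h2 : T * W <= 2 * W by rewrite ler_wpM2r.
  rewrite mulrDr; rewrite mulrBl mul1r in h1.
  by move: (T * P) (T * W) (2 * tau * E) h1 h2 => u v w h1 h2; clear - h1 h2; lra.
have l1 : D * (P - W) <= D * S1 by apply: ler_wpM2l.
have l2 : P - 2 * tau * E - W <= D * (P - W).
  have h1 : (1 - D) * P <= 2 * tau * E.
    apply: ler_pM => //; first by rewrite subr_ge0.
    by clear - D1 dtau tau0; lra.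
  have h2 : D * W <= W by rewrite ler_piMl.
  rewrite mulrBl mul1r in h1; rewrite mulrBr.
  by move: (D * P) (D * W) (2 * tau * E) h1 h2 => u v w h1 h2; clear - h1 h2; lra.
apply/andP; split.
  by clear - l1 l2 low etaE WV W0; lra.
by clear - u1 u2 up etaE WV W0; lra.
Qed.

End Approximation.

(** * Asymptotics *)

Section Asymptotics.
Context {R : realType}.
Implicit Types (alpha C c y t eta kappa : R) (f g e : R -> R).

Lemma eqaddO_pinftyP f g e :
  f = g +O_ (+oo_R) e <->
  exists C M : R, 0 <= C /\ forall x, M < x -> `|f x - g x| <= C * `|e x|.
Proof.
split=> [/eqaddOP/bigO_exP [k k0 [M [_ hM]]]|[C [M [C0 hM]]]].
  by exists k, M; split=> //; apply: ltW.
apply/eqaddOP; exists C; split; first exact: num_real.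
move=> k Ck; exists M; split; first exact: num_real.
by move=> x /hM /le_trans; apply; rewrite ler_wpM2r // ltW.
Qed.

(** The relative error of the theorem, at y = ln x. *)
Definition decay c y : R := expR (- (c * Num.sqrt (y * ln y))).

Lemma decay_le c c' y : c <= c' -> decay c' y <= decay c y.
Proof. by move=> cc; rewrite ler_expR lerN2 ler_wpM2r ?sqrtr_ge0. Qed.

Lemma decay_antitone c y y' : 0 <= c -> 1 <= y -> y <= y' -> decay c y' <= decay c y.
Proof.
move=> c0 y1 yy; rewrite ler_expR lerN2 ler_wpM2l // ler_sqrt; last first.
  by rewrite mulr_ge0 ?ln_ge0 ?(le_trans y1) // (le_trans ler01) // (le_trans y1).
have y0 : 0 < y by apply: lt_le_trans y1.
apply: ler_pM => //; first exact: ltW.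
  exact: ln_ge0.
by rewrite ler_ln ?posrE // (lt_le_trans y0).
Qed.

Lemma sqrt_exp_mul_ge t : 1 <= t -> expR (t / 2) <= Num.sqrt (expR t * ln (expR t)).
Proof.
move=> t1; rewrite expRK.
have -> : expR (t / 2) = Num.sqrt (expR (t / 2) ^+ 2).
  by rewrite sqrtr_sqr ger0_norm ?expR_ge0.
rewrite ler_sqrt; last by rewrite mulr_ge0 ?expR_ge0 // (le_trans ler01).
rewrite -expRM_natl mulrC divfK // ler_peMr ?expR_ge0 //.
Qed.

Lemma decay_small c eta y : 0 < c -> 0 < eta ->
  exists Y : R, [/\ y <= Y, 1 <= Y & decay c Y <= eta].
Proof.
move=> c0 eta0.
(* With Y = exp t, sqrt (Y ln Y) >= exp (t / 2) >= t / 2, and exp (- v) <= 1 / (1 + v); hence 2 / (c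
   eta). *)
set t := Num.max (Num.max 1 y) (2 / (c * eta)).
have t1 : 1 <= t by rewrite !le_max lexx.
have ty : y <= t by rewrite !le_max lexx orbT.
have te : 2 / (c * eta) <= t by rewrite le_max lexx orbT.
have et : t <= expR t by have := expR_ge1Dx t; lra.
exists (expR t); split.
- exact: le_trans ty et.
- exact: le_trans t1 et.
have h : eta^-1 <= c * Num.sqrt (expR t * ln (expR t)).
  apply: (@le_trans _ _ (c * (t / 2))).
    rewrite ler_pdivrMr ?mulr_gt0 // in te.
    rewrite -[leLHS]mul1r ler_pdivrMr //.
    have -> : c * (t / 2) * eta = t * (c * eta) / 2 by ring.
    by rewrite ler_pdivlMr // mul1r.
  rewrite ler_pM2l //; apply: le_trans (sqrt_exp_mul_ge t t1).
  by have := expR_ge1Dx (t / 2); lra.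
have v0 : 0 <= c * Num.sqrt (expR t * ln (expR t)).
  by rewrite mulr_ge0 ?sqrtr_ge0 // ltW.
apply: le_trans (expRN_le_invD1 _ v0) _.
rewrite invf_ple ?posrE //; last by rewrite ltr_pwDl.
by apply: le_trans h _; rewrite lerDr.
Qed.

Lemma exp_beats_linear d ep C : 0 < d -> 0 < ep -> 0 <= C ->
  exists2 t1, 1 <= t1 & forall t, t1 <= t -> C * t <= d * expR (ep * t).
Proof.
move=> d0 ep0 C0; have K0 : 0 < d * ep ^+ 2 by rewrite mulr_gt0 ?exprn_gt0.
exists (Num.max 1 (2 * C / (d * ep ^+ 2))); first by rewrite le_max lexx.
move=> t; rewrite ge_max ler_pdivrMr // => /andP[t1 tC].
have t0 : 0 <= t by apply: le_trans t1.
have et0 : 0 <= ep * t by rewrite mulr_ge0 // ltW.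
have h := expR_ge1Dxn 1 et0; rewrite (_ : 2`!%N = 2%N) // in h.
have h2 := ler_wpM2l (ltW d0) h.
have h3 := ler_wpM2r t0 tC.
apply: le_trans h2.
have e1 : d * (1 + (ep * t) ^+ 2 / 2) = d + t * (d * ep ^+ 2) * t / 2 by field.
rewrite e1; move: (t * (d * ep ^+ 2) * t) h3 => u h3.
by clear - h3 d0; lra.
Qed.

(* The optimal weight is lam = kappa ln y with kappa close to 1/2: then
   exp lam * ln y is negligible against sqrt (y ln y). *)
Lemma error_term_decay alpha C c : 0 < alpha -> 0 <= C ->
  c < Num.sqrt (2 * alpha) ->
  exists2 y1, 1 <= y1 & forall y, y1 <= y ->
    exists2 lam, 0 <= lam & error_term alpha C lam y <= decay c y.
Proof.
move=> a0 C0 cs.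
wlog c0 : c cs / 0 <= c.
  move=> wl; have [c0|c0] := leP 0 c; first exact: wl.
  have [|y1 y11 h] := wl 0 _ (lexx 0); first by rewrite sqrtr_gt0 mulr_gt0.
  exists y1 => // y /h [lam l0 hl]; exists lam => //.
  by apply: le_trans hl (decay_le _ _ _ _); apply: ltW.
have a4 : 0 < 4 * alpha by rewrite mulr_gt0.
have c2 : c ^+ 2 < 2 * alpha.
  have a2 : 0 <= 2 * alpha by rewrite mulr_ge0 // ltW.
  by rewrite -(sqr_sqrtr a2) ltr_pXn2r ?nnegrE ?sqrtr_ge0.
(* At kappa = q the main exponent 2 sqrt (alpha kappa) equals c. Any kappa strictly between q and
   1/2 leaves a margin d > 0 and keeps y^kappa ln y below sqrt (y ln y); the midpoint is taken. *)
set q := c ^+ 2 / (4 * alpha).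
have q0 : 0 <= q by rewrite divr_ge0 ?sqr_ge0 // ltW.
have q2 : q < 1 / 2 by rewrite /q ltr_pdivrMr //; lra.
set kappa := (q + 1 / 2) / 2.
have k0 : 0 < kappa by rewrite /kappa; lra.
have k2 : kappa < 1 / 2 by rewrite /kappa; lra.
have qk : q < kappa by rewrite /kappa; lra.
set d := 2 * Num.sqrt (alpha * kappa) - c.
have d0 : 0 < d.
  have s0 : 0 <= 2 * Num.sqrt (alpha * kappa) by rewrite mulr_ge0 ?sqrtr_ge0.
  rewrite subr_gt0 -(ltr_pXn2r (n := 2)) ?nnegrE //.
  rewrite exprMn sqr_sqrtr; last by rewrite mulr_ge0 ?ltW.
  by move: qk; rewrite /q ltr_pdivrMr //; clear; lra.
clearbody kappa; clear q q0 q2 qk.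
have ep0 : 0 < 1 / 2 - kappa by rewrite subr_gt0.
(* For t = ln y >= 1, ln (2 + y) <= t + 2 gives C + 4 ln (2 + y) <= (C + 12) t; one more t absorbs
   lam. *)
have C13 : 0 <= C + 13 by rewrite addr_ge0.
have [t1 t11 ht] := exp_beats_linear d (1 / 2 - kappa) (C + 13) d0 ep0 C13.
exists (expR t1).
  by apply: expR_ge1; apply: le_trans t11.
move=> y y1; have y0 : 0 < y by apply: lt_le_trans y1; apply: expR_gt0.
have [t yE] : exists t, y = expR t by exists (ln y); rewrite lnK ?posrE.
have lnyE : ln y = t by rewrite yE expRK.
have tt1 : t1 <= t by rewrite yE ler_expR in y1.
have t1' : 1 <= t by apply: le_trans tt1.
have t0 : 0 <= t by apply: le_trans t1'.
exists (kappa * t); first by rewrite mulr_ge0 // ltW.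
rewrite ler_expR lnyE.
have sE : Num.sqrt (alpha * (kappa * t) * y) = Num.sqrt (alpha * kappa) * Num.sqrt (y * t).
  rewrite -sqrtrM; last by rewrite mulr_ge0 // ltW.
  by congr Num.sqrt; ring.
rewrite sE.
have lny : ln (2 + y) <= t + 2.
  rewrite -ler_expR lnK ?posrE; last by rewrite ltr_pwDl // ltW.
  have ee : 1 <= expR t by apply: expR_ge1.
  rewrite yE expRD; have := ler_wpM2l (expR_ge0 t) (expR_ge1Dx 2).
  by move: (expR t * expR 2) (expR t) ee => u v; clear; lra.
have big : kappa * t + expR (kappa * t) * (C + 4 * ln (2 + y)) <=
    expR (kappa * t) * ((C + 13) * t).
  have E1 : 1 <= expR (kappa * t) by apply: expR_ge1; rewrite mulr_ge0 // ltW.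
  have h1 : C + 4 * ln (2 + y) <= (C + 12) * t.
    have Ct : C <= C * t by rewrite ler_peMr.
    rewrite [leRHS]mulrDl; move: (C * t) (ln (2 + y)) Ct lny => u v Ct lny.
    by clear - Ct lny t1'; lra.
  have h2 := ler_wpM2l (expR_ge0 (kappa * t)) h1.
  have h3 : kappa * t <= expR (kappa * t) * t.
    apply: ler_wpM2r => //; apply: le_trans E1.
    by clear - k2; lra.
  have -> : expR (kappa * t) * ((C + 13) * t) =
     expR (kappa * t) * t + expR (kappa * t) * ((C + 12) * t) by ring.
  exact: lerD.
have fin : expR (kappa * t) * ((C + 13) * t) <= d * Num.sqrt (y * t).
  apply: (@le_trans _ _ (d * expR (t / 2))); last first.
    by rewrite ler_pM2l // -lnyE [in leRHS]yE lnyE; apply: sqrt_exp_mul_ge.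
  have := ler_wpM2l (expR_ge0 (kappa * t)) (ht t tt1).
  move=> /le_trans; apply; rewrite le_eqVlt; apply/orP; left; apply/eqP.
  by rewrite mulrCA -expRD; congr (_ * expR _); field.
have := le_trans big fin; rewrite /d mulrBl -mulrA.
move: (kappa * t) (expR (kappa * t) * (C + 4 * ln (2 + y))) => u v.
by move: (Num.sqrt (alpha * kappa) * Num.sqrt (y * t)) (c * Num.sqrt (y * t)) => a b; clear; lra.
Qed.

(** Values at y and Y are compared through a Phi common to both, then eta tends to 0: g is Cauchy at
    infinity, with the stated rate. *)
Lemma uniform_approx_limit (g : R -> R) alpha C : 0 < alpha -> 0 <= C ->
  (forall Y eta, 0 <= Y -> 0 < eta -> exists2 Phi, `|Phi| <= C &
     forall y lam, 0 <= y <= Y -> 0 <= lam ->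
       `|g y - expR Phi| <= C * error_term alpha C lam y + eta) ->
  exists2 rho, 0 < rho & forall c, c < Num.sqrt (2 * alpha) ->
    exists y1 : R, forall y, y1 <= y -> `|g y - rho| <= 2 * C * decay c y.
Proof.
move=> a0 C0 approx.
have cauchy c : 0 <= c -> c < Num.sqrt (2 * alpha) -> exists2 y1, 1 <= y1 &
    forall y Y, y1 <= y -> y1 <= Y -> `|g y - g Y| <= C * decay c y + C * decay c Y /\
      expR (- C) - C * decay c y <= g y.
  move=> c0 cs; have [y1 y11 hy] := error_term_decay alpha C c a0 C0 cs.
  exists y1 => // y Y y1y y1Y.
  have y0 : 0 <= y by rewrite (le_trans _ y1y) // (le_trans ler01).
  have Y0 : 0 <= Y by rewrite (le_trans _ y1Y) // (le_trans ler01).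
  have [lam l0 hl] := hy y y1y; have [lam' l0' hl'] := hy Y y1Y.
  have near eta : 0 < eta -> exists2 Phi, `|Phi| <= C &
      `|g y - expR Phi| <= C * decay c y + eta /\ `|g Y - expR Phi| <= C * decay c Y + eta.
    move=> eta0; have mY : 0 <= Num.max y Y by rewrite le_max y0.
    have [Phi PhiC h] := approx (Num.max y Y) eta mY eta0.
    exists Phi => //; split.
      have yY : 0 <= y <= Num.max y Y by rewrite y0 le_max lexx.
      by apply: le_trans (h y lam yY l0) _; rewrite lerD2r ler_wpM2l.
    have yY : 0 <= Y <= Num.max y Y by rewrite Y0 le_max lexx orbT.
    by apply: le_trans (h Y lam' yY l0') _; rewrite lerD2r ler_wpM2l.
  move: near; move: (C * decay c y) (C * decay c Y) => A B near.
  split; apply/ler_addgt0Pr => e e0.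
    have e2 : 0 < e / 2 by rewrite divr_gt0.
    have [Phi _ [h1 h2]] := near _ e2.
    have -> : g y - g Y = (g y - expR Phi) - (g Y - expR Phi) by ring.
    apply: le_trans (ler_normB _ _) _; apply: le_trans (lerD h1 h2) _.
    by clear; lra.
  have [Phi PhiC [h1 _]] := near _ e0.
  have eC : expR (- C) <= expR Phi.
    by rewrite ler_expR; move: PhiC; rewrite ler_norml => /andP[].
  move: h1; rewrite ler_distl => /andP[h1 _]; clear - h1 eC.
  by move: (expR (- C)) (expR Phi) (g y) h1 eC => u v w; lra.
(* One fixed admissible rate defines rho, which must not depend on c. *)
set c0 := Num.sqrt (2 * alpha) / 2.
have s0 : 0 < Num.sqrt (2 * alpha) by rewrite sqrtr_gt0 mulr_gt0.
have c00 : 0 < c0 by rewrite divr_gt0.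
have c0s : c0 < Num.sqrt (2 * alpha) by rewrite /c0; clear - s0; lra.
have [y0 y01 h0] := cauchy c0 (ltW c00) c0s.
have D0 c y : 0 <= C * decay c y by rewrite mulr_ge0 // expR_ge0.
have anti c y Y : 0 <= c -> 1 <= y -> y <= Y -> C * decay c Y <= C * decay c y.
  by move=> *; rewrite ler_wpM2l // decay_antitone.
have close y Y : y0 <= y -> y0 <= Y -> g y - 2 * (C * decay c0 y) <= g Y + 2 * (C * decay c0 Y).
  move=> yy yY; have [hh _] := h0 y Y yy yY.
  move: hh; rewrite ler_distl => /andP[_ hh].
  move: (D0 c0 y) (D0 c0 Y) hh; move: (C * decay c0 y) (C * decay c0 Y) => A B.
  by clear; lra.
(* By [close], every lower end g - 2 C decay lies below every upper end g + 2 C decay, so the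
   supremum of the lower ends lies in all these intervals. *)
pose S := [set z | exists2 y, y0 <= y & z = g y - 2 * (C * decay c0 y)].
have Sub Y : y0 <= Y -> ubound S (g Y + 2 * (C * decay c0 Y)).
  by move=> yY _ [y yy ->]; apply: close.
have S0 : S !=set0 by exists (g y0 - 2 * (C * decay c0 y0)); exists y0.
have Ssup : has_sup S by split=> //; exists (g y0 + 2 * (C * decay c0 y0)); apply: Sub.
set rho := sup S.
have rho_close y : y0 <= y -> `|g y - rho| <= 2 * (C * decay c0 y).
  move=> yy; rewrite ler_distl lerBlDr; apply/andP; split; last first.
    by rewrite -lerBlDr; apply: ub_le_sup => //; [case: Ssup | exists y].
  by apply: ge_sup => //; apply: Sub.
exists rho.
  (* As |Phi| <= C, rho >= exp (- C) - 3 C decay; at a Y where 4 C decay <= exp (- C), this is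
     positive. *)
  have e0 : 0 < expR (- C) / (4 * (C + 1)).
    by rewrite divr_gt0 ?expR_gt0 // mulr_gt0 // ltr_wpDl.
  have [Y [y0Y _ DY]] := decay_small c0 _ y0 c00 e0.
  have [_ low] := h0 Y Y y0Y y0Y.
  have := rho_close Y y0Y; rewrite ler_distl => /andP[_ up].
  have h3 : 4 * (C * decay c0 Y) <= expR (- C).
    rewrite ler_pdivlMr in DY; last by rewrite mulr_gt0 // ltr_wpDl.
    apply: le_trans DY; have -> : decay c0 Y * (4 * (C + 1)) =
      4 * (C * decay c0 Y) + 4 * decay c0 Y by ring.
    by rewrite lerDl mulr_ge0 // expR_ge0.
  have := expR_gt0 (- C); move: (expR (- C)) h3 low up; move: (C * decay c0 Y) (g Y) => A B u.
  by clear; lra.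
move=> c cs; set c1 := Num.max c c0.
have c10 : 0 <= c1 by rewrite le_max (ltW c00) orbT.
have c1s : c1 < Num.sqrt (2 * alpha) by rewrite gt_max cs.
have [y1 y11 h1] := cauchy c1 c10 c1s.
exists (Num.max y0 y1) => y; rewrite ge_max => /andP[y0y y1y].
apply: (@le_trans _ _ (2 * C * decay c1 y)); last first.
  by rewrite ler_wpM2l ?mulr_ge0 // decay_le // le_max lexx.
have y1' : 1 <= y by apply: le_trans y1y.
apply/ler_addgt0Pr => e e0.
have e1 : 0 < e / (2 * (C + 1)) by rewrite divr_gt0 // mulr_gt0 // ltr_wpDl.
(* From y to a far point Y the rate is c1; the weaker rate c0 enters only from Y to rho, where it
   costs at most e. *)
have [Y [yY _ DY]] := decay_small c0 _ y c00 e1.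
have [hh _] := h1 y Y y1y (le_trans y1y yY).
have := rho_close Y (le_trans y0y yY).
have an := anti c1 y Y c10 y1' yY.
have h3 : 2 * (C * decay c0 Y) <= e.
  rewrite ler_pdivlMr in DY; last by rewrite mulr_gt0 // ltr_wpDl.
  apply: le_trans DY; have -> : decay c0 Y * (2 * (C + 1)) =
    2 * (C * decay c0 Y) + 2 * decay c0 Y by ring.
  by rewrite lerDl mulr_ge0 // expR_ge0.
move=> h2; have -> : g y - rho = (g y - g Y) + (g Y - rho) by ring.
apply: le_trans (ler_normD _ _) _; apply: le_trans (lerD hh h2) _.
rewrite -mulrA; move: (C * decay c1 y) (C * decay c1 Y) (C * decay c0 Y) an h3 => A B D an h3.
by clear - an h3; lra.
Qed.

End Asymptotics.

(** * From the hypothesis on Pi to the asymptotics of N *)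

(** Below the threshold of the O-term, Pi is bounded by monotonicity and the integral by exp W, and
    exp (theta w) >= 1; a larger constant covers all w >= 0. *)
Lemma riemann_error_exp (R : realType) (p : nat -> R) (theta : R) :
  beurling_primes p -> 0 <= theta ->
  riemann_count p = (fun x : R => prime_integral x) +O_ (+oo_R) (fun x : R => x `^ theta) ->
  exists2 C0 : R, 0 <= C0 & forall w, 0 <= w ->
    `|riemann_count p (expR w) - prime_integral (expR w)| <= C0 * expR (theta * w).
Proof.
move=> hp th0 /eqaddO_pinftyP [C [M [C0 hM]]].
set W := Num.max 0 M.
have W0 : 0 <= W by rewrite le_max lexx.
have [J pJ] := beurling_primes_eventually_gt p (expR W) hp.
have rc w : 0 <= w <= W -> 0 <= riemann_count p (expR w) <= riemann_count p (expR W).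
  move=> /andP[w0 wW]; rewrite !(riemann_count_exp _ _ J) //; last first.
    by move=> j /pJ; apply: le_lt_trans; rewrite ler_expR.
  apply/andP; split.
    by apply: sumr_ge0 => j _; apply: sumr_ge0 => i _; rewrite invr_ge0.
  apply: ler_sum => j _; apply: le_harmonic_sum; apply: Num.Theory.le_truncn.
  by rewrite ler_pM2r // invr_gt0 ln_prime_gt0.
have rW0 : 0 <= riemann_count p (expR W).
  by have /rc /andP[] : 0 <= W <= W by rewrite W0 lexx.
move: (riemann_count p (expR W)) rc rW0 => rW rc rW0.
have K0 : 0 <= C + rW + expR W.
  by apply: addr_ge0; [apply: addr_ge0 | apply: expR_ge0].
exists (C + rW + expR W) => // w w0.
have e1 : 1 <= expR (theta * w) by apply: expR_ge1; apply: mulr_ge0.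
have [wW|Ww] := leP w W.
  have wI : 0 <= w <= W by rewrite w0.
  have /andP[r0 r1] := rc w wI.
  have ew1 : 1 <= expR w by apply: expR_ge1.
  have /andP[i0 i1] := prime_integral_le_sub 1 (expR w) (lexx _) ew1.
  rewrite prime_integral1 subr0 in i0 i1.
  have ewW : expR w <= expR W by rewrite ler_expR.
  move: (riemann_count p (expR w)) (prime_integral (expR w)) r0 r1 i0 i1
    => a i r0 r1 i0 i1.
  apply: (@le_trans _ _ (C + rW + expR W)); last by rewrite ler_peMr.
  rewrite ler_norml; move: (expR w) (expR W) ewW i1 {K0} => u v ewW i1.
  by clear - C0 r0 r1 i0 i1 rW0 ewW; apply/andP; split; lra.
have Mw : M < expR w.
  have hw := expR_ge1Dx w; have hM' : M <= W by rewrite le_max lexx orbT.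
  by move: (expR w) hw => u h; clear - h hM' Ww; lra.
have := hM _ Mw; rewrite -expRM (ger0_norm (expR_ge0 _)) [w * theta]mulrC => h.
apply: le_trans h _; apply: ler_wpM2r; first exact: expR_ge0.
rewrite -addrA lerDl; apply: addr_ge0 => //; exact: expR_ge0.
Qed.

Theorem theoremA1 (R : realType) (p : nat -> R) (hp : beurling_primes p)
    (theta : R) (theta_ge0 : 0 <= theta) (theta_lt1 : theta < 1)
    (hPi : riemann_count p =
       (fun x : R => \int[lebesgue_measure]_(u in `[1, x]) ((1 - u^-1) / ln u))
         +O_ (+oo_R) (fun x : R => x `^ theta)) :
  exists2 rho : R, 0 < rho &
    forall c : R, c < Num.sqrt (2 * (1 - theta)) ->
      (fun x : R => (integer_count p x)%:R) =
        (fun x : R => rho * x)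
          +O_ (+oo_R) (fun x : R => x * expR (- c * Num.sqrt (ln x * ln (ln x)))).
Proof.
have [C0 C00 hw] := riemann_error_exp _ p theta hp theta_ge0 hPi.
have [C CC0 approx] := integer_count_approx p theta C0 hp theta_ge0 theta_lt1 C00 hw.
have al0 : 0 < 1 - theta by rewrite subr_gt0.
have [rho rho0 hrho] := uniform_approx_limit
  (fun y => (integer_count p (expR y))%:R * expR (- y)) _ C al0 CC0 approx.
exists rho => // c cs; have [y1 hy1] := hrho c cs.
apply/eqaddO_pinftyP; exists (2 * C), (Num.max 1 (expR y1)).
split=> [|x]; first by rewrite mulr_ge0.
rewrite gt_max => /andP[x1 xy].
have x0 : 0 < x by apply: lt_trans x1.
have xE : expR (ln x) = x by rewrite lnK ?posrE.
have yx : y1 <= ln x by rewrite -ler_expR xE ltW.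
have := hy1 _ yx; rewrite expRN xE => h.
have -> : (integer_count p x)%:R - rho * x = x * ((integer_count p x)%:R / x - rho).
  by field; rewrite gt_eqF.
rewrite !normrM (gtr0_norm x0) mulrCA ler_pM2l // (ger0_norm (expR_ge0 _)) mulNr.
exact: h.
Qed.
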